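(* The Shatah-Turok-Spergel wave map $\psi^T(t,r)=2\arctan\left(\frac{r}{T-t}\right)$ is mode stable, i.e.: let $\lambda\in\mathbb{C}$ with $\operatorname{Re}\lambda\ge 0$ and $\lambda\neq 1$. Then there does not exist a nontrivial (not identically zero) function $u_\lambda\in C^\infty[0,1]$ (complex-valued) satisfying $$-(1-\rho^2)u_\lambda''(\rho)-2\frac{1-\rho^2}{\rho}u_\lambda'(\rho)+2\lambda\rho\, u_\lambda'(\rho)+\lambda(\lambda+1)u_\lambda(\rho)+\frac{V(\rho)}{\rho^2}u_\lambda(\rho)=0\qquad\text{for }\rho\in(0,1),$$ where $$V(\rho)=2\cos(4\arctan\rho)=\frac{2(1-6\rho^2+\rho^4)}{(1+\rho^2)^2}.$$
   Context: The function $\psi^T(t,r)=2\arctan\left(\frac{r}{T-t}\right)$ (with $T$ a free parameter, the blowup time) is a self-similar solution of the co-rotational wave maps equation $\psi_{tt}-\psi_{rr}-\frac{2}{r}\psi_r+\frac{\sin(2\psi)}{r^2}=0$. In coordinates $\tau=-\log(T-t)$, $\rho=\frac{r}{T-t}$ with $\rho\in[0,1]$, inserting $2\arctan(\rho)+e^{\lambda\tau}u_\lambda(\rho)$ and linearizing in $u_\lambda$ gives the ODE in the claim. A nontrivial solution $u_\lambda\in C^\infty[0,1]$ of this ODE with $\operatorname{Re}\lambda\ge 0$ is called an unstable mode; $\lambda=1$ has the unstable mode $\frac{2\rho}{1+\rho^2}$ (the symmetry mode). Mode stability of $\psi^T$ means that there are no unstable modes except the symmetry mode. $C^\infty[0,1]$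 denotes complex-valued functions smooth up to and including the endpoints. *)

(* Defs.v *)
From Stdlib Require Import Reals Lra.
From Coquelicot Require Import Coquelicot.

Open Scope R_scope.

(* Derivative of [f] at [x] relative to [D]: only the values of [f] on [D]
   matter, so it is one-sided at an endpoint of an interval. *)
Definition is_derive_on (D : R -> Prop) (f : R -> C) (x : R) (l : C) : Prop :=
  @filterdiff R_AbsRing R_NormedModule C_R_NormedModule
    f (within D (locally x)) (fun h => scal h l).

(* The functions [g n] are the successive derivatives of [f] on [D]; each is
   continuous on [D] because it is differentiable there. *)
Definition smooth_on (D : R -> Prop) (f : R -> C) : Prop :=
  exists g : nat -> R -> C,
    (forall x, D x -> g 0%nat x = f x) /\
    (forall n x, D x -> is_derive_on D (g n) x (g (S n) x)).

Definition unit_interval (x : R) : Prop := 0 <= x <= 1.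

(* Total derivative operator for [R -> C], since Coquelicot's [Derive] is for
   [R -> R] only; meaningful where [f] is differentiable (see
   [is_derive_CDerive]). *)
Definition CDerive (f : R -> C) (x : R) : C :=
  (Derive (fun t => Re (f t)) x, Derive (fun t => Im (f t)) x).

Definition V (rho : R) : R := 2 * cos (4 * atan rho).

Definition mode_equation (lambda : C) (u : R -> C) (rho : R) : Prop :=
  (- RtoC (1 - rho ^ 2)%R * CDerive (CDerive u) rho
   - RtoC (2 * ((1 - rho ^ 2) / rho))%R * CDerive u rho
   + 2 * lambda * RtoC rho * CDerive u rho
   + lambda * (lambda + 1) * u rho
   + RtoC (V rho / rho ^ 2)%R * u rho = 0)%C.

Lemma is_derive_CDerive (f : R -> C) (x : R) (l : C) :
  @is_derive R_AbsRing C_R_NormedModule f x l -> CDerive f x = l.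
Proof.
intros H. destruct l as [a b]. unfold CDerive. f_equal; apply is_derive_unique.
- apply (filterdiff_comp' f (fun z : C_R_NormedModule => Re z) x _ (fun z => Re z) H).
  apply filterdiff_linear, is_linear_fst.
- apply (filterdiff_comp' f (fun z : C_R_NormedModule => Im z) x _ (fun z => Im z) H).
  apply filterdiff_linear, is_linear_snd.
Qed.

Lemma is_derive_on_interior (D : R -> Prop) (f : R -> C) (x : R) (l : C) :
  locally x D -> is_derive_on D f x l ->
  @is_derive R_AbsRing C_R_NormedModule f x l.
Proof.
intros HD [Hl H]. split; [exact Hl|]. intros y Hy eps.
assert (Hy' : is_filter_lim (within D (locally x)) y).
{ intros P HP. apply filter_le_within. exact (Hy P HP). }
generalize (filter_and _ _ HD (H y Hy' eps)). apply filter_imp.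
intros t [Ht Hd]. exact (Hd Ht).
Qed.

Lemma V_rational (rho : R) :
  V rho = 2 * (1 - 6 * rho ^ 2 + rho ^ 4) / (1 + rho ^ 2) ^ 2.
Proof.
assert (Hp : 0 < 1 + rho ^ 2) by nra.
assert (Hc : cos (2 * atan rho) = (1 - rho ^ 2) / (1 + rho ^ 2)).
{ rewrite cos_2a, cos_atan, sin_atan.
  replace (rho²) with (rho ^ 2) by (unfold Rsqr; ring).
  assert (Hs := sqrt_sqrt _ (Rlt_le _ _ Hp)).
  assert (Hs0 := sqrt_lt_R0 _ Hp).
  revert Hs Hs0. generalize (sqrt (1 + rho ^ 2)). intros s Hs Hs0.
  rewrite <- Hs. field. lra. }
unfold V. replace (4 * atan rho) with (2 * (2 * atan rho)) by ring.
rewrite cos_2a_cos, Hc. field; lra.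
Qed.

(* Main.v *)
Require Import Defs.
From Stdlib Require Import Reals Lra Lia.
From Coquelicot Require Import Coquelicot.
Open Scope R_scope.

(** The symmetry mode [2 rho / (1 + rho^2)] at [lambda = 1] is removed by a
    Darboux transformation: if [u] solves the mode equation, then
      [y = ((1 - rho^2) u' - ((1 - rho^2)^2 / (rho (1 + rho^2)) + (lambda - 1) rho) u) / rho^2]
    solves
      [(1 - rho^2) y'' + (6 / rho - 2 (lambda + 3) rho) y'
         - ((lambda + 2) (lambda + 3) - 8 / (1 + rho^2)) y = 0],
    and [y = 0] forces [u = 0] when [lambda <> 1].

    In the variable [w = 1 - rho^2] the solution smooth at [w = 0] has Taylor
    coefficients [b_n] with
      [4 (n+1) (n+lambda) b_(n+1) = (2n+lambda+2) (2n+lambda+3) b_n - 4 S_n],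
      [S_n = sum_(k <= n) 2^(k-n) b_k].
    For [Re lambda >= 0] the bound [|S_n| <= 5/2 |b_n|] propagates by induction,
    hence [b_n ~ c n^(3/2)] with [c <> 0], and this solution blows up
    at [rho = 0] at least like [rho^(-4)].

    If [W] is the Wronskian of [y] and that solution, then [rho^12 |W|^2] is
    nondecreasing and tends to [0] as [rho -> 1], because [u] is smooth up to
    [rho = 1].  So [W = 0] and [y] is a multiple of the blowing-up solution
    near [0].  As [y = O(rho^(-3))], the multiple is zero, so [u] vanishes near
    [0] and hence everywhere. *)

(** * Frobenius coefficients at the light cone and the bound on their convolution *)

(** Cauchy-Schwarz, read off from [Re (z * Cconj w)]. It bounds a product of moduli from below by a
    real polynomial, without square roots. *)
Lemma Cmod_mult_ge (z w : C) : Re z * Re w + Im z * Im w <= Cmod z * Cmod w.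
Proof.
rewrite <- (Cmod_conj w), <- Cmod_mult.
replace (Re z * Re w + Im z * Im w) with (Re (z * Cconj w)%C)
  by (unfold Re, Im; simpl; ring).
eapply Rle_trans; [apply Rle_abs | apply re_le_Cmod].
Qed.

(** Replaces a modulus by a quadratic polynomial so that [nra] applies. The bound is sharp at
    [Cmod z = k], so [k] is a guess for the modulus where the target inequality is tight. *)
Lemma Cmod_le_AMGM (z : C) (k : R) :
  0 < k -> 2 * k * Cmod z <= Re z ^ 2 + Im z ^ 2 + k ^ 2.
Proof. intros Hk. rewrite <- Cmod2_alt. generalize (pow2_ge_0 (Cmod z - k)). nra. Qed.

Lemma Cneq_0_Re (z : C) : 0 < Re z -> z <> 0%C.
Proof. intros H E. rewrite E in H. simpl in H. lra. Qed.

(** [frob lambda n] is the pair [(b_(n+1), S_(n+1))]; the series is normalised by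
    [b_0 = 4 lambda], which makes the step from [b_0] to [b_1] free of the
    division by [lambda]. *)
Fixpoint frob (lambda : C) (n : nat) : C * C :=
  match n with
  | O => (lambda * lambda + 5 * lambda + 2, lambda * lambda + 7 * lambda + 2)%C
  | S k =>
      let m := RtoC (INR n) in
      let b := ((((2 * m + lambda + 2) * (2 * m + lambda + 3) * fst (frob lambda k)
                   - 4 * snd (frob lambda k)) / (4 * (m + 1) * (m + lambda))))%C in
      (b, b + snd (frob lambda k) / 2)%C
  end.

Definition frob_coef (lambda : C) (n : nat) : C :=
  match n with O => 4 * lambda | S k => fst (frob lambda k) end.

Definition frob_conv (lambda : C) (n : nat) : C :=
  match n with O => 4 * lambda | S k => snd (frob lambda k) end.

Lemma INR_add_neq_0 (lambda : C) (n : nat) :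
  0 <= Re lambda -> (RtoC (INR (S n)) + lambda)%C <> 0%C.
Proof.
intros Hl. apply Cneq_0_Re.
change (0 < INR (S n) + Re lambda). generalize (lt_0_INR (S n)).
intros H. assert (0 < INR (S n)) by (apply H; lia). lra.
Qed.

Lemma INR_1_neq_0 (n : nat) : (RtoC (INR n) + 1)%C <> 0%C.
Proof.
apply Cneq_0_Re. change (0 < INR n + 1). generalize (pos_INR n). lra.
Qed.

Lemma frob_rec (lambda : C) (n : nat) : 0 <= Re lambda ->
  (4 * (RtoC (INR n) + 1) * (RtoC (INR n) + lambda) * frob_coef lambda (S n)
   = (2 * RtoC (INR n) + lambda + 2) * (2 * RtoC (INR n) + lambda + 3)
       * frob_coef lambda n - 4 * frob_conv lambda n)%C.
Proof.
intros Hl. destruct n as [|n].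
- simpl. ring.
- cbn [frob_coef frob_conv frob fst].
  field. split; [apply INR_add_neq_0, Hl | apply INR_1_neq_0].
Qed.

Lemma frob_conv_rec (lambda : C) (n : nat) :
  frob_conv lambda (S n) = (frob_coef lambda (S n) + frob_conv lambda n / 2)%C.
Proof.
destruct n as [|n]; [|reflexivity].
simpl. field.
Qed.

(** Since [Re (b_1 * Cconj lambda) = |lambda|^2 Re lambda + 5 |lambda|^2 + 2 Re lambda], one gets
    [5 |lambda| <= |b_1|]. With [S_1 = b_1 + 2 lambda] this gives the factor [1 + 2/5]. *)
Lemma frob_bound_start (lambda : C) : 0 <= Re lambda ->
  frob_coef lambda 1 <> 0%C /\
  Cmod (frob_conv lambda 1) <= 7 / 5 * Cmod (frob_coef lambda 1).
Proof.
intros Hl. cbn [frob_coef frob_conv frob fst snd].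
set (b := (lambda * lambda + 5 * lambda + 2)%C).
assert (H : 5 * Cmod lambda <= Cmod b).
{ destruct (Rle_lt_or_eq_dec _ _ (Cmod_ge_0 lambda)) as [Hp|Hp];
    [|rewrite <- Hp, Rmult_0_r; apply Cmod_ge_0].
  apply (Rmult_le_reg_l _ _ _ Hp).
  replace (Cmod lambda * (5 * Cmod lambda)) with (5 * Cmod lambda ^ 2) by ring.
  rewrite Cmod2_alt. eapply Rle_trans; [|apply Cmod_mult_ge].
  destruct lambda as [x y]. unfold b, Re, Im in *. simpl in *.
  assert (0 <= x * (x * x + y * y + 2)) by (apply Rmult_le_pos; nra). lra. }
split.
- intros E. rewrite E, Cmod_0 in H.
  assert (E' : lambda = 0%C) by (apply Cmod_eq_0; generalize (Cmod_ge_0 lambda); lra).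
  unfold b in E. rewrite E' in E. apply (f_equal Re) in E. simpl in E. lra.
- replace (lambda * lambda + 7 * lambda + 2)%C with (b + 2 * lambda)%C
    by (unfold b; ring).
  eapply Rle_trans; [apply Cmod_triangle|].
  rewrite Cmod_mult, Cmod_R, Rabs_pos_eq by lra. lra.
Qed.

(** The numerical hypothesis yields [M |b_m| <= 3 |b_(m+1)|] through the recurrence. Then
    [S_(m+1) = b_(m+1) + S_m / 2] gives [|S_(m+1)| <= (1 + 3/2) |b_(m+1)|], so 3 is exactly what
    reproduces 5/2. The incoming constant [M] is left free because the first step needs a smaller
    one. *)
Lemma frob_bound_step (lambda : C) (n : nat) (M : R) : 0 <= Re lambda -> 0 < M ->
  4 * M * (INR (S n) + 1) * Cmod (RtoC (INR (S n)) + lambda)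
    <= 3 * ((2 * INR (S n) + Re lambda + 2) * (2 * INR (S n) + Re lambda + 3)
            + Im lambda ^ 2 - 4 * M) ->
  frob_coef lambda (S n) <> 0%C ->
  Cmod (frob_conv lambda (S n)) <= M * Cmod (frob_coef lambda (S n)) ->
  frob_coef lambda (S (S n)) <> 0%C /\
  Cmod (frob_conv lambda (S (S n))) <= 5 / 2 * Cmod (frob_coef lambda (S (S n))).
Proof.
intros Hl HM Hin Hb Hs.
generalize (frob_rec lambda (S n) Hl) (frob_conv_rec lambda (S n)).
assert (Hm0 := INR_add_neq_0 lambda n Hl).
assert (Hm : 0 < INR (S n)) by (apply lt_0_INR; lia).
revert Hin Hb Hs Hm0 Hm. generalize (INR (S n)). intros m Hin Hb Hs Hm0 Hm.
generalize (frob_coef lambda (S (S n))) (frob_conv lambda (S (S n))).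
revert Hb Hs. generalize (frob_coef lambda (S n)) (frob_conv lambda (S n)).
intros b s Hb Hs b' s' Hrec Hs'.
set (P := Cmod (2 * RtoC m + lambda + 2) * Cmod (2 * RtoC m + lambda + 3)).
(* Both factors have imaginary part [Im lambda], so [Cmod_mult_ge] produces the term
   [Im lambda ^ 2]. *)
assert (HP : (2 * m + Re lambda + 2) * (2 * m + Re lambda + 3) + Im lambda ^ 2 <= P).
{ eapply Rle_trans; [|apply Cmod_mult_ge].
  destruct lambda as [x y]. unfold Re, Im; simpl. lra. }
apply Cmod_gt_0 in Hb. apply Cmod_gt_0 in Hm0.
assert (H1 : (P - 4 * M) * Cmod b <= 4 * (m + 1) * Cmod (RtoC m + lambda) * Cmod b').
{ replace (4 * (m + 1) * Cmod (RtoC m + lambda) * Cmod b')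
    with (Cmod (4 * (RtoC m + 1) * (RtoC m + lambda) * b')).
  2:{ replace (4 * (RtoC m + 1))%C with (RtoC (4 * (m + 1)))
        by (rewrite RtoC_mult, RtoC_plus; reflexivity).
      rewrite !Cmod_mult, Cmod_R, Rabs_pos_eq by lra. reflexivity. }
  rewrite Hrec.
  assert (T := Cmod_triangle ((2 * RtoC m + lambda + 2) * (2 * RtoC m + lambda + 3) * b - 4 * s) (4 * s)).
  replace ((2 * RtoC m + lambda + 2) * (2 * RtoC m + lambda + 3) * b - 4 * s + 4 * s)%C
    with ((2 * RtoC m + lambda + 2) * (2 * RtoC m + lambda + 3) * b)%C in T by ring.
  rewrite !Cmod_mult, (Cmod_R 4), Rabs_pos_eq in T by lra. fold P in T. lra. }
set (D := 4 * (m + 1) * Cmod (RtoC m + lambda)) in *.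
assert (HD : 0 < D) by (unfold D; repeat apply Rmult_lt_0_compat; lra).
assert (H2 : M * D <= 3 * (P - 4 * M)) by (unfold D; lra).
assert (H3 : M * Cmod b <= 3 * Cmod b').
{ apply (Rmult_le_reg_l D); [exact HD|].
  assert (M * D * Cmod b <= 3 * (P - 4 * M) * Cmod b)
    by (apply Rmult_le_compat_r; lra). lra. }
assert (HMb : 0 < M * Cmod b) by (apply Rmult_lt_0_compat; lra).
split; [apply Cmod_gt_0; lra|].
rewrite Hs'. eapply Rle_trans; [apply Cmod_triangle|].
unfold Cdiv. rewrite Cmod_mult, Cmod_inv, Cmod_R, Rabs_pos_eq by
 (try lra; apply Cneq_0_Re; simpl; lra). lra.
Qed.

Lemma frob_bound (lambda : C) (n : nat) : 0 <= Re lambda ->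
  frob_coef lambda (S n) <> 0%C /\
  Cmod (frob_conv lambda (S n)) <= 5 / 2 * Cmod (frob_coef lambda (S n)).
Proof.
intros Hl. destruct n as [|n].
{ destruct (frob_bound_start lambda Hl) as [H1 H2]. split; [exact H1|].
  generalize (Cmod_ge_0 (frob_coef lambda 1)). lra. }
induction n as [|n IH].
- destruct (frob_bound_start lambda Hl) as [H1 H2].
  (* For m = 1 and M = 5/2 the numerical hypothesis fails, for instance at [lambda = 2 sqrt 2 i] (60
     against 54); hence the sharper starting constant 7/5. *)
  apply (frob_bound_step lambda 0 (7 / 5)); try assumption; try lra.
  generalize (Cmod_le_AMGM (RtoC (INR 1) + lambda) 3).
  destruct lambda as [x y]. unfold Re, Im in *. simpl in *. nra.
- destruct IH as [H1 H2].
  apply (frob_bound_step lambda (S n) (5 / 2)); try assumption; try lra.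
  assert (Hm : 2 <= INR (S (S n))) by (apply (le_INR 2); lia).
  revert Hm. generalize (INR (S (S n))). intros m Hm.
  (* [7/4] approximates [sqrt 3]: for large [m] the inequality is tightest
     near [Im lambda = sqrt 2 * m], where [|m + lambda| = sqrt 3 * m]. *)
  assert (HA := Cmod_le_AMGM (RtoC m + lambda) (7 / 4 * (m + 1))).
  revert HA. generalize (Cmod (RtoC m + lambda)). intros c HA.
  destruct lambda as [x y]. unfold Re, Im in *. simpl in *. nra.
Qed.

(** * Growth of the coefficients *)

Lemma bounded_initial_segment (f : nat -> R) (N : nat) :
  exists D, 0 <= D /\ forall n, (n < N)%nat -> f n <= D.
Proof.
induction N as [|N [D [HD H]]].
- exists 0. split; [lra|]. intros n Hn. lia.
- exists (Rmax D (f N)). split; [generalize (Rmax_l D (f N)); lra|].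
  intros n Hn. destruct (PeanoNat.Nat.eq_dec n N) as [->|]; [apply Rmax_r|].
  eapply Rle_trans; [apply H; lia | apply Rmax_l].
Qed.

(** Relative increments of size [K / n^2] are summable, so from some index on [p] stays in a disk
    around [p N] that excludes 0. The sum is controlled by the telescoping majorant
    [1/N - 1/(N+k)]. *)
Lemma quadratic_perturbation (p : nat -> C) (K : R) : 0 <= K ->
  (forall n, INR (S n) ^ 2 * Cmod (p (S n) - p n) <= K * Cmod (p n)) ->
  exists N, forall k, Cmod (p (N + k)%nat - p N) <= 1 / 2 * Cmod (p N).
Proof.
intros HK Hp.
destruct (nfloor_ex (4 * K + 1)) as [N0 HN0]; [lra|].
set (N := S N0).
(* This makes the total deviation factor [2 K / N] at most 1/2. *)
assert (HN : 4 * K + 1 <= INR N) by (unfold N; rewrite S_INR; lra).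
exists N.
assert (Hstrong : forall k,
  Cmod (p (N + k)%nat - p N) <= 2 * K * Cmod (p N) * (/ INR N - / INR (N + k))).
2:{ intros k. eapply Rle_trans; [apply Hstrong|].
    assert (0 < / INR (N + k)) by (apply Rinv_0_lt_compat; rewrite plus_INR; generalize (pos_INR k); lra).
    assert (H2 : 2 * K * / INR N <= 1 / 2).
    { apply (Rmult_le_reg_r (INR N)); [lra|]. rewrite Rmult_assoc, Rinv_l; lra. }
    generalize (Cmod_ge_0 (p N)). intros H3.
    assert (0 <= K * Cmod (p N)) by (apply Rmult_le_pos; lra).
    assert (0 <= K * Cmod (p N) * / INR (N + k)) by (apply Rmult_le_pos; lra).
    assert (2 * K * / INR N * Cmod (p N) <= 1 / 2 * Cmod (p N)) by (apply Rmult_le_compat_r; lra).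
    lra. }
induction k as [|k IH].
- rewrite PeanoNat.Nat.add_0_r.
  replace (p N - p N)%C with (RtoC 0) by ring. rewrite Cmod_0. lra.
- assert (Hn : INR N <= INR (N + k)) by (apply le_INR; lia).
  specialize (Hp (N + k)%nat).
  rewrite <- plus_n_Sm. rewrite S_INR in Hp |- *.
  revert Hp IH Hn. generalize (INR (N + k)) (p (N + k)%nat) (p (S (N + k))).
  intros x q q' Hp IH Hn.
  set (M := Cmod (p N)) in *. assert (HM : 0 <= M) by apply Cmod_ge_0.
  assert (HKM : 0 <= K * M) by (apply Rmult_le_pos; lra).
  assert (Hx : 0 < / x) by (apply Rinv_0_lt_compat; lra).
  assert (Hx1 : / (x + 1) <= / x) by (apply Rinv_le_contravar; lra).
  assert (HNi : 2 * K * / INR N <= 1 / 2).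
  { apply (Rmult_le_reg_r (INR N)); [lra|]. rewrite Rmult_assoc, Rinv_l; lra. }
  assert (Hq : Cmod q <= 3 / 2 * M).
  { replace q with ((q - p N) + p N)%C by ring.
    eapply Rle_trans; [apply Cmod_triangle|]. fold M.
    assert (0 <= K * M * / x) by (apply Rmult_le_pos; lra).
    assert (2 * K * / INR N * M <= 1 / 2 * M) by (apply Rmult_le_compat_r; lra).
    lra. }
  (* The induction hypothesis gives [|q| <= 3/2 M], and [1/(x+1)^2 <= 1/x - 1/(x+1)]; the constant 2
     leaves room above 3/2. *)
  assert (Hd : Cmod (q' - q) <= 2 * K * M * (/ x - / (x + 1))).
  { apply (Rmult_le_reg_l ((x + 1) ^ 2)); [apply pow_lt; lra|].
    eapply Rle_trans; [exact Hp|].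
    replace ((x + 1) ^ 2 * (2 * K * M * (/ x - / (x + 1))))
      with (2 * (K * M) * (1 + / x)) by (field; lra).
    assert (K * Cmod q <= K * (3 / 2 * M)) by (apply Rmult_le_compat_l; lra).
    assert (0 <= K * M * / x) by (apply Rmult_le_pos; lra). lra. }
  replace (q' - p N)%C with ((q' - q) + (q - p N))%C by ring.
  eapply Rle_trans; [apply Cmod_triangle|]. lra.
Qed.

(** The Taylor coefficients of [(1 - w)^(-5/2)]. *)
Fixpoint binom52 (n : nat) : R :=
  match n with
  | O => 1
  | S k => binom52 k * ((INR k + 5 / 2) / (INR k + 1))
  end.

(** The true order is [n^(3/2)]. The integer powers on either side suffice: the upper one for
    convergence in the unit disk, the lower one for a double pole at [w = 1]. *)
Lemma binom52_bounds (n : nat) : INR n + 1 <= binom52 n <= (INR n + 1) ^ 2.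
Proof.
induction n as [|n IH].
- simpl. lra.
- rewrite S_INR. cbn [binom52]. assert (Hn := pos_INR n).
  revert IH Hn. generalize (binom52 n) (INR n). intros c x [H1 H2] Hx.
  assert (Hi : 0 < (x + 5 / 2) / (x + 1)) by (apply Rdiv_lt_0_compat; lra).
  split.
  + apply Rle_trans with ((x + 1) * ((x + 5 / 2) / (x + 1))).
    * field_simplify; lra.
    * apply Rmult_le_compat_r; lra.
  + apply Rle_trans with ((x + 1) ^ 2 * ((x + 5 / 2) / (x + 1))).
    * apply Rmult_le_compat_r; lra.
    * replace ((x + 1) ^ 2 * ((x + 5 / 2) / (x + 1))) with ((x + 1) * (x + 5 / 2))
        by (field; lra). nra.
Qed.

(** The exponent 5/2 is the one for which the ratio of consecutive [frob_coef] agrees with that of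
    [binom52] up to relative order [1/n^2], as [quadratic_perturbation] requires. *)
Lemma frob_ratio (lambda : C) (n : nat) : 0 <= Re lambda ->
  let q k := (frob_coef lambda k / RtoC (binom52 k))%C in
  INR (S n) ^ 2 * Cmod (q (S (S n)) - q (S n))
    <= (Cmod lambda ^ 2 + 5 * Cmod lambda + 16) * Cmod (q (S n)).
Proof.
intros Hl q. unfold q.
generalize (frob_rec lambda (S n) Hl) (frob_bound lambda n Hl).
change (binom52 (S (S n)))
  with (binom52 (S n) * ((INR (S n) + 5 / 2) / (INR (S n) + 1))).
generalize (binom52_bounds (S n)).
assert (Hm0 := INR_add_neq_0 lambda n Hl).
assert (Hm : 0 < INR (S n)) by (apply lt_0_INR; lia).
revert Hm0 Hm. generalize (INR (S n)) (binom52 (S n)). intros m be Hm0 Hm [Hbe _].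
generalize (frob_coef lambda (S (S n))) (frob_coef lambda (S n)) (frob_conv lambda (S n)).
intros b' b s Hrec [Hb Hs].
assert (Hbe0 : RtoC be <> 0%C) by (apply Cneq_0_Re; simpl; lra).
assert (Hm1 : (RtoC m + 1)%C <> 0%C) by (apply Cneq_0_Re; simpl; lra).
assert (Hm5 : (2 * RtoC m + 5)%C <> 0%C) by (apply Cneq_0_Re; simpl; lra).
(* What remains of [(2m+lambda+2)(2m+lambda+3) b - 4 s] after subtracting [4 (m+lambda)(m+5/2) b]:
   the powers of [m] cancel. *)
set (e := ((lambda * lambda - 5 * lambda + 6) * b - 4 * s)%C).
(* Here 16 is [6 + 4 * 5/2], the latter from [|s| <= 5/2 |b|]. *)
assert (He : Cmod e <= (Cmod lambda ^ 2 + 5 * Cmod lambda + 16) * Cmod b).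
{ replace e with ((lambda * lambda * b + (- (5)) * lambda * b) + (6 * b + (- (4)) * s))%C
    by (unfold e; ring).
  eapply Rle_trans; [apply Cmod_triangle|].
  assert (T1 := Cmod_triangle (lambda * lambda * b) (- (5) * lambda * b)).
  assert (T2 := Cmod_triangle (6 * b) (- (4) * s)).
  rewrite (Cmod_mult _ b), !Cmod_mult, Cmod_opp, Cmod_R, Rabs_pos_eq in T1 by lra.
  rewrite !Cmod_mult, Cmod_opp, !Cmod_R, !Rabs_pos_eq in T2 by lra.
  assert (H0 := Cmod_ge_0 b). lra. }
assert (Hq : (b' / RtoC (be * ((m + 5 / 2) / (m + 1))) - b / RtoC be)%C
  = (e / (2 * (RtoC m + lambda) * (2 * RtoC m + 5) * RtoC be))%C).
{ rewrite !RtoC_mult, RtoC_div, !RtoC_plus, RtoC_div by lra.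
  replace b' with (((2 * RtoC m + lambda + 2) * (2 * RtoC m + lambda + 3) * b - 4 * s)
     / (4 * (RtoC m + 1) * (RtoC m + lambda)))%C
   by (rewrite <- Hrec; field; split; assumption).
  unfold e. field. repeat split; assumption. }
rewrite Hq. unfold Cdiv. rewrite !Cmod_mult, !Cmod_inv, !Cmod_mult; try assumption.
2:{ repeat apply Cmult_neq_0; try assumption; apply Cneq_0_Re; simpl; lra. }
rewrite (Cmod_R be), (Cmod_R 2), !Rabs_pos_eq by lra.
assert (HA : m <= Cmod (RtoC m + lambda)).
{ eapply Rle_trans; [|apply re_le_Cmod]. eapply Rle_trans; [|apply Rle_abs].
  change (m <= m + Re lambda). lra. }
assert (HB : 2 * m <= Cmod (2 * RtoC m + 5)).
{ eapply Rle_trans; [|apply re_le_Cmod]. eapply Rle_trans; [|apply Rle_abs].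
  simpl. lra. }
revert HA HB. generalize (Cmod (RtoC m + lambda)) (Cmod (2 * RtoC m + 5)).
intros A B HA HB.
assert (HAB1 : m * (2 * m) <= A * B) by (apply Rmult_le_compat; lra).
assert (Hmm : 0 < m * m) by (apply Rmult_lt_0_compat; lra).
assert (HAB : m ^ 2 <= 2 * A * B) by lra.
assert (HAB0 : 0 < 2 * A * B) by lra.
rewrite (Rinv_mult (2 * A * B)), <- !Rmult_assoc.
apply Rmult_le_compat_r; [left; apply Rinv_0_lt_compat; lra|].
eapply Rle_trans; [|exact He].
apply (Rmult_le_reg_r (2 * A * B)); [exact HAB0|].
rewrite Rmult_assoc, Rinv_l by lra.
generalize (Cmod_ge_0 e). nra.
Qed.

Lemma frob_asymptotics (lambda : C) : 0 <= Re lambda ->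
  exists (N : nat) (Q : C), Q <> 0%C /\ forall n, (N <= n)%nat ->
    Cmod (frob_coef lambda n / RtoC (binom52 n) - Q) <= 1 / 2 * Cmod Q.
Proof.
intros Hl.
(* The sequence is shifted by one because [frob_bound] starts at index 1: [b_0 = 4 lambda] vanishes
   for [lambda = 0]. The resulting [Q] is the quotient at one large index, not the limit. *)
destruct (quadratic_perturbation
  (fun n => frob_coef lambda (S n) / RtoC (binom52 (S n)))%C
  (Cmod lambda ^ 2 + 5 * Cmod lambda + 16)) as [N HN].
- generalize (Cmod_ge_0 lambda) (pow2_ge_0 (Cmod lambda)). lra.
- intros n. apply frob_ratio, Hl.
- exists (S N), (frob_coef lambda (S N) / RtoC (binom52 (S N)))%C. split.
  + assert (Hb : RtoC (binom52 (S N)) <> 0%C).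
    { apply Cneq_0_Re. cbn [Re fst RtoC].
      generalize (binom52_bounds (S N)) (pos_INR (S N)). lra. }
    apply Cmod_gt_0. rewrite Cmod_div by exact Hb.
    apply Rdiv_lt_0_compat; apply Cmod_gt_0; [apply frob_bound, Hl | exact Hb].
  + intros n Hn. replace n with (S (N + (n - S N))) by lia. apply HN.
Qed.

Lemma frob_upper (lambda : C) : 0 <= Re lambda ->
  exists K, forall n, Cmod (frob_coef lambda n) <= K * (INR n + 1) ^ 2.
Proof.
intros Hl. destruct (frob_asymptotics lambda Hl) as [N [Q [_ HQ]]].
destruct (bounded_initial_segment (fun n => Cmod (frob_coef lambda n)) N) as [D [HD H]].
exists (D + 3 / 2 * Cmod Q). intros n.
assert (H0 := Cmod_ge_0 Q). assert (Hn := pos_INR n).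
destruct (PeanoNat.Nat.lt_ge_cases n N) as [HnN|HnN].
- specialize (H n HnN). cbv beta in H. nra.
- specialize (HQ n HnN). destruct (binom52_bounds n) as [H1 H2].
  assert (Hz : RtoC (binom52 n) <> 0%C) by (apply Cneq_0_Re; cbn [Re fst RtoC]; lra).
  replace (frob_coef lambda n)
    with (((frob_coef lambda n / RtoC (binom52 n) - Q) + Q) * RtoC (binom52 n))%C
    by (field; exact Hz).
  rewrite Cmod_mult, Cmod_R, Rabs_pos_eq by lra.
  assert (T := Cmod_triangle (frob_coef lambda n / RtoC (binom52 n) - Q) Q).
  apply Rmult_le_compat; try apply Cmod_ge_0; lra.
Qed.

(** For large [n] the quotients [b_n / binom52 n] lie in a disk of radius [|Q|/2] around [Q];
    multiplying by the conjugate of [Q] turns them to the right, with real part at least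
    [|Q|^2 / 2]. The constant [D] absorbs the finitely many earlier coefficients. *)
Lemma frob_lower (lambda : C) : 0 <= Re lambda ->
  exists (Q : C) (d D : R), 0 < d /\
    forall n, d * (INR n + 1) - D <= Re (Q * frob_coef lambda n)%C.
Proof.
intros Hl. destruct (frob_asymptotics lambda Hl) as [N [Q [HQ0 HQ]]].
apply Cmod_gt_0 in HQ0.
set (d := 1 / 2 * Cmod Q ^ 2).
assert (Hd : 0 < d) by (unfold d; apply Rmult_lt_0_compat; [lra | apply pow_lt; lra]).
destruct (bounded_initial_segment
  (fun n => d * (INR n + 1) - Re (Cconj Q * frob_coef lambda n)%C) N) as [D [HD H]].
exists (Cconj Q), d, D. split; [exact Hd|]. intros n.
destruct (PeanoNat.Nat.lt_ge_cases n N) as [HnN|HnN].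
- specialize (H n HnN). cbv beta in H. lra.
- specialize (HQ n HnN). destruct (binom52_bounds n) as [H1 H2].
  assert (Hn := pos_INR n).
  assert (Hz : RtoC (binom52 n) <> 0%C) by (apply Cneq_0_Re; cbn [Re fst RtoC]; lra).
  set (r := (frob_coef lambda n / RtoC (binom52 n) - Q)%C) in *.
  replace (frob_coef lambda n) with ((r + Q) * RtoC (binom52 n))%C
    by (unfold r; field; exact Hz).
  replace (Re (Cconj Q * ((r + Q) * RtoC (binom52 n)))%C)
    with ((Re (Cconj Q * r)%C + (Re Q ^ 2 + Im Q ^ 2)) * binom52 n)
    by (unfold Re, Im; simpl; ring).
  rewrite <- Cmod2_alt.
  assert (Hr : - d <= Re (Cconj Q * r)%C).
  { assert (T := re_le_Cmod (Cconj Q * r)%C).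
    rewrite Cmod_mult, Cmod_conj in T.
    assert (T' := Rle_abs (- Re (Cconj Q * r)%C)). rewrite Rabs_Ropp in T'.
    unfold d. nra. }
  assert (d * (INR n + 1) <= d * binom52 n) by (apply Rmult_le_compat_l; lra).
  assert (d * binom52 n <= (Re (Cconj Q * r)%C + Cmod Q ^ 2) * binom52 n)
    by (apply Rmult_le_compat_r; unfold d in *; lra).
  lra.
Qed.

(** * The solution regular at the light cone *)

Lemma CV_radius_ge_1 (a : nat -> R) (K : R) :
  (forall n, Rabs (a n) <= K * (INR n + 1) ^ 2) -> Rbar_le 1 (CV_radius a).
Proof.
intros Ha.
assert (Hin : forall r, 0 <= r < 1 -> Rbar_le r (CV_radius a)).
{ intros r Hr. apply (proj1 (CV_radius_bounded a)).
  set (h := (1 - r) / 4). assert (Hh : 0 < h) by (unfold h; lra).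
  (* Bernoulli gives [h (n+1) <= (1+h)^n]; two such factors are beaten by [r^n]. *)
  assert (Hq : (1 + h) * ((1 + h) * r) <= 1) by (unfold h; nra).
  exists (K * / h ^ 2). intros n.
  assert (HK : 0 <= K) by (specialize (Ha 0%nat); generalize (Rabs_pos (a 0%nat)); simpl in Ha; lra).
  assert (Hn := pos_INR n).
  assert (Hb : h * (INR n + 1) <= (1 + h) ^ n).
  { eapply Rle_trans; [|apply poly, Hh]. unfold h in *. lra. }
  assert (Hb0 : 0 <= h * (INR n + 1)) by (apply Rmult_le_pos; lra).
  assert (Hrn : 0 <= r ^ n) by (apply pow_le; lra).
  rewrite Rabs_mult, (Rabs_pos_eq (r ^ n)) by exact Hrn.
  apply Rle_trans with (K * (INR n + 1) ^ 2 * r ^ n).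
  { apply Rmult_le_compat_r; [exact Hrn | apply Ha]. }
  rewrite Rmult_assoc. apply Rmult_le_compat_l; [exact HK|].
  apply (Rmult_le_reg_l (h ^ 2)); [apply pow_lt; lra|].
  rewrite Rinv_r by (apply pow_nonzero; lra).
  replace (h ^ 2 * ((INR n + 1) ^ 2 * r ^ n))
    with ((h * (INR n + 1)) * (h * (INR n + 1)) * r ^ n) by ring.
  apply Rle_trans with ((1 + h) ^ n * (1 + h) ^ n * r ^ n).
  { apply Rmult_le_compat_r; [exact Hrn|]. apply Rmult_le_compat; lra. }
  rewrite Rmult_assoc, <- !Rpow_mult_distr.
  apply Rle_trans with (1 ^ n); [|rewrite pow1; lra].
  apply pow_incr. split; [|exact Hq]. repeat apply Rmult_le_pos; lra. }
apply Rbar_not_lt_le. intros Hlt.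
assert (H0 := CV_radius_ge_0 a).
destruct (CV_radius a) as [c| |]; simpl in *; try contradiction.
assert (H := Hin ((c + 1) / 2)). simpl in H. lra.
Qed.

Lemma is_pseries_nonneg (a : nat -> R) (w l : R) :
  0 <= w -> (forall n, 0 <= a n) -> is_pseries a w l -> 0 <= l.
Proof.
intros Hw Ha Hl. apply is_pseries_R in Hl.
apply (is_lim_seq_le (fun _ => 0) (sum_n (fun n => a n * w ^ n)) 0 l).
- intros n. induction n as [|n IH].
  + rewrite sum_O. apply Rmult_le_pos; [apply Ha | apply pow_le, Hw].
  + rewrite sum_Sn. apply Rplus_le_le_0_compat; [exact IH|].
    apply Rmult_le_pos; [apply Ha | apply pow_le, Hw].
- apply is_lim_seq_const.
- exact Hl.
Qed.

Lemma is_pseries_geom (w : R) :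
  Rabs w < 1 -> is_pseries (fun _ => 1) w (/ (1 - w)).
Proof.
intros Hw. apply is_pseries_R.
apply (is_series_ext (fun n => w ^ n)); [intros n; symmetry; apply Rmult_1_l|].
apply is_series_geom, Hw.
Qed.

Lemma is_pseries_geom_derive (w : R) :
  Rabs w < 1 -> is_pseries (fun n => INR n + 1) w (/ (1 - w) ^ 2).
Proof.
intros Hw.
assert (HR : Rbar_lt (Rabs w) (CV_radius (fun _ => 1))).
{ eapply Rbar_lt_le_trans; [exact (Hw : Rbar_lt (Rabs w) 1)|].
  apply (CV_radius_ge_1 _ 1). intros n. rewrite Rabs_R1.
  generalize (pos_INR n). nra. }
apply (is_pseries_ext (PS_derive (fun _ => 1))).
{ intros n. unfold PS_derive. rewrite S_INR. apply Rmult_1_r. }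
replace (/ (1 - w) ^ 2) with (Derive (PSeries (fun _ => 1)) w).
{ apply is_pseries_derive, HR. }
rewrite (Derive_ext_loc _ (fun x => / (1 - x))).
- apply is_derive_unique. apply Rabs_def2 in Hw. auto_derive; [lra | field; lra].
- assert (Hp : 0 < 1 - Rabs w) by lra.
  exists (mkposreal _ Hp). intros x Hx.
  apply is_pseries_unique, is_pseries_geom.
  replace x with ((x - w) + w) by ring.
  eapply Rle_lt_trans; [apply Rabs_triang|].
  assert (Hx' : Rabs (x - w) < 1 - Rabs w) by exact Hx. lra.
Qed.

(** * Complex-valued derivatives and power series of a real variable *)

(** Taken componentwise, so that the rules for real functions and [auto_derive] apply to each part;
    likewise for series and limits below. *)
Definition is_Cderive (f : R -> C) (x : R) (l : C) : Prop :=
  is_derive (fun t => Re (f t)) x (Re l) /\ is_derive (fun t => Im (f t)) x (Im l).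

Definition is_Cpseries (b : nat -> C) (w : R) (l : C) : Prop :=
  is_pseries (fun n => Re (b n)) w (Re l) /\ is_pseries (fun n => Im (b n)) w (Im l).

Definition CPSeries (b : nat -> C) (w : R) : C :=
  (PSeries (fun n => Re (b n)) w, PSeries (fun n => Im (b n)) w).

Definition converges_in_disk (b : nat -> C) : Prop :=
  Rbar_le 1 (CV_radius (fun n => Re (b n))) /\ Rbar_le 1 (CV_radius (fun n => Im (b n))).

Definition CPS_derive (b : nat -> C) (n : nat) : C := (RtoC (INR (S n)) * b (S n))%C.

Definition CPS_incr (b : nat -> C) (n : nat) : C :=
  match n with O => 0%C | S k => b k end.

Lemma im_le_Cmod (z : C) : Rabs (Im z) <= Cmod z.
Proof. eapply Rle_trans; [apply Rmax_r | apply Rmax_Cmod]. Qed.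

Lemma is_Cpseries_plus (a b : nat -> C) (w : R) (la lb : C) :
  is_Cpseries a w la -> is_Cpseries b w lb ->
  is_Cpseries (fun n => a n + b n)%C w (la + lb)%C.
Proof.
intros [Ha1 Ha2] [Hb1 Hb2]. split.
- exact (is_pseries_plus _ _ _ _ _ Ha1 Hb1).
- exact (is_pseries_plus _ _ _ _ _ Ha2 Hb2).
Qed.

Lemma is_Cpseries_scal (c : C) (b : nat -> C) (w : R) (l : C) :
  is_Cpseries b w l -> is_Cpseries (fun n => c * b n)%C w (c * l)%C.
Proof.
intros [H1 H2].
assert (S : forall (k : R) a s, is_pseries a w s -> is_pseries (fun n => k * a n) w (k * s)).
{ intros k a s Hs. exact (is_pseries_scal k a w s (Rmult_comm _ _) Hs). }
split.
- exact (is_pseries_minus _ _ _ _ _ (S (Re c) _ _ H1) (S (Im c) _ _ H2)).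
- exact (is_pseries_plus _ _ _ _ _ (S (Re c) _ _ H2) (S (Im c) _ _ H1)).
Qed.

Lemma is_Cpseries_incr (b : nat -> C) (w : R) (l : C) :
  is_Cpseries b w l -> is_Cpseries (CPS_incr b) w (RtoC w * l)%C.
Proof.
intros [H1 H2]. split.
- replace (Re (RtoC w * l)%C) with (w * Re l) by (unfold Re; simpl; ring).
  eapply is_pseries_ext; [|exact (is_pseries_incr_1 _ _ _ H1)].
  intros [|n]; reflexivity.
- replace (Im (RtoC w * l)%C) with (w * Im l) by (unfold Im; simpl; ring).
  eapply is_pseries_ext; [|exact (is_pseries_incr_1 _ _ _ H2)].
  intros [|n]; reflexivity.
Qed.

Lemma is_Cpseries_zero (b : nat -> C) (w : R) (l : C) :
  (forall n, b n = 0%C) -> is_Cpseries b w l -> l = 0%C.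
Proof.
intros Hb [H1 H2].
assert (Z : forall a s, (forall n : nat, a n = 0) -> is_pseries a w s -> s = 0).
{ intros a s Ha Hs. apply is_pseries_unique in Hs. rewrite <- Hs.
  rewrite (PSeries_ext _ (fun _ => 0) w Ha). apply PSeries_const_0. }
destruct l as [x y]. apply Z in H1, H2; try (intros n; rewrite Hb; reflexivity).
simpl in H1, H2. now rewrite H1, H2.
Qed.

Lemma converges_in_disk_poly (b : nat -> C) (K : R) :
  (forall n, Cmod (b n) <= K * (INR n + 1) ^ 2) -> converges_in_disk b.
Proof.
intros Hb. split; apply (CV_radius_ge_1 _ K); intros n;
  (eapply Rle_trans; [|apply Hb]); [apply re_le_Cmod | apply im_le_Cmod].
Qed.

Lemma converges_in_disk_derive (b : nat -> C) :
  converges_in_disk b -> converges_in_disk (CPS_derive b).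
Proof.
intros [H1 H2]. split.
- rewrite (CV_radius_ext _ (PS_derive (fun n => Re (b n)))).
  + now rewrite CV_radius_derive.
  + intros n. unfold CPS_derive, PS_derive, Re. cbn [fst snd Cmult RtoC]. ring.
- rewrite (CV_radius_ext _ (PS_derive (fun n => Im (b n)))).
  + now rewrite CV_radius_derive.
  + intros n. unfold CPS_derive, PS_derive, Im. cbn [fst snd Cmult RtoC]. ring.
Qed.

Lemma CPSeries_correct (b : nat -> C) (w : R) :
  converges_in_disk b -> Rabs w < 1 -> is_Cpseries b w (CPSeries b w).
Proof.
intros [H1 H2] Hw. split; apply PSeries_correct, CV_radius_inside;
  (eapply Rbar_lt_le_trans; [exact (Hw : Rbar_lt (Rabs w) 1)|]); assumption.
Qed.

Lemma is_Cderive_CPSeries (b : nat -> C) (w : R) :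
  converges_in_disk b -> Rabs w < 1 ->
  is_Cderive (CPSeries b) w (CPSeries (CPS_derive b) w).
Proof.
intros [H1 H2] Hw. split; cbn [Re Im CPSeries fst snd].
- rewrite (PSeries_ext (fun n => fst (CPS_derive b n)) (PS_derive (fun n => Re (b n)))).
  + apply is_derive_PSeries.
    eapply Rbar_lt_le_trans; [exact (Hw : Rbar_lt (Rabs w) 1) | exact H1].
  + intros n. unfold CPS_derive, PS_derive, Re. cbn [fst snd Cmult RtoC]. ring.
- rewrite (PSeries_ext (fun n => snd (CPS_derive b n)) (PS_derive (fun n => Im (b n)))).
  + apply is_derive_PSeries.
    eapply Rbar_lt_le_trans; [exact (Hw : Rbar_lt (Rabs w) 1) | exact H2].
  + intros n. unfold CPS_derive, PS_derive, Im. cbn [fst snd Cmult RtoC]. ring.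
Qed.

Lemma frob_converges (lambda : C) :
  0 <= Re lambda -> converges_in_disk (frob_coef lambda).
Proof.
intros Hl. destruct (frob_upper lambda Hl) as [K HK].
exact (converges_in_disk_poly _ K HK).
Qed.

Lemma frob_conv_converges (lambda : C) :
  0 <= Re lambda -> converges_in_disk (frob_conv lambda).
Proof.
intros Hl. destruct (frob_upper lambda Hl) as [K HK].
apply (converges_in_disk_poly _ (5 / 2 * K)). intros n.
apply Rle_trans with (5 / 2 * Cmod (frob_coef lambda n)).
- destruct n as [|n]; [|apply frob_bound, Hl].
  change (frob_conv lambda 0) with (frob_coef lambda 0).
  generalize (Cmod_ge_0 (frob_coef lambda 0)). lra.
- rewrite Rmult_assoc. apply Rmult_le_compat_l; [lra | apply HK].
Qed.

(** * The Frobenius solution: its equation and its blow-up *)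

Definition frob_sol (lambda : C) : R -> C := CPSeries (frob_coef lambda).
Definition frob_sol' (lambda : C) : R -> C := CPSeries (CPS_derive (frob_coef lambda)).
Definition frob_sol'' (lambda : C) : R -> C :=
  CPSeries (CPS_derive (CPS_derive (frob_coef lambda))).

(** The non-polynomial coefficient [8 / (2 - w)] is [4 / (1 - w/2)], a geometric series. Its product
    with the solution is therefore 4 times the series of [frob_conv], and everything else has
    polynomial coefficients. *)
Lemma frob_sol_equation (lambda : C) (w : R) : 0 <= Re lambda -> Rabs w < 1 ->
  (4 * RtoC w * (1 - RtoC w) * frob_sol'' lambda w
   + (4 * lambda - (4 * lambda + 14) * RtoC w) * frob_sol' lambda w
   - ((lambda + 2) * (lambda + 3) - 8 / (2 - RtoC w)) * frob_sol lambda w = 0)%C.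
Proof.
intros Hl Hw.
assert (D0 := frob_converges lambda Hl).
assert (D1 := converges_in_disk_derive _ D0).
assert (D2 := converges_in_disk_derive _ D1).
assert (P0 := CPSeries_correct _ w D0 Hw). fold (frob_sol lambda w) in P0.
assert (P1 := CPSeries_correct _ w D1 Hw). fold (frob_sol' lambda w) in P1.
assert (P2 := CPSeries_correct _ w D2 Hw). fold (frob_sol'' lambda w) in P2.
assert (PS := CPSeries_correct _ w (frob_conv_converges lambda Hl) Hw).
revert P0 P1 P2 PS.
generalize (frob_sol lambda w) (frob_sol' lambda w) (frob_sol'' lambda w)
  (CPSeries (frob_conv lambda) w).
intros y y1 y2 s P0 P1 P2 PS.
(* Coefficientwise this is [frob_rec]; multiplication by [w] shifts indices by up to two, hence the
   separate cases n = 0 and n = 1. *)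
assert (E1 : (4 * (RtoC w * y2) + ((- (4)) * (RtoC w * (RtoC w * y2)) + (4 * lambda * y1
  + ((- (4 * lambda + 14)) * (RtoC w * y1) + ((- ((lambda + 2) * (lambda + 3))) * y + 4 * s)))))%C = 0%C).
{ eapply (is_Cpseries_zero _ w); cycle 1.
  - repeat (apply is_Cpseries_plus || apply is_Cpseries_incr || apply is_Cpseries_scal);
      eassumption.
  - intros n. cbv beta.
    assert (Hs : (4 * frob_conv lambda n
      = (2 * RtoC (INR n) + lambda + 2) * (2 * RtoC (INR n) + lambda + 3) * frob_coef lambda n
        - 4 * (RtoC (INR n) + 1) * (RtoC (INR n) + lambda) * frob_coef lambda (S n))%C)
      by (rewrite (frob_rec lambda n Hl); ring).
    rewrite Hs.
    destruct n as [|[|n]]; unfold CPS_incr, CPS_derive; rewrite ?S_INR, ?RtoC_plus;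
      change (RtoC (INR 0)) with (RtoC 0); ring. }
(* This is [(1 - w/2) s = y], coefficientwise [frob_conv_rec]. *)
assert (E2 : (s + (- (1)) * y + (- (1 / 2)) * (RtoC w * s))%C = 0%C).
{ eapply (is_Cpseries_zero _ w); cycle 1.
  - repeat (apply is_Cpseries_plus || apply is_Cpseries_incr || apply is_Cpseries_scal);
      eassumption.
  - intros [|n]; unfold CPS_incr; cbv beta iota.
    + change (frob_conv lambda 0) with (frob_coef lambda 0). ring.
    + rewrite frob_conv_rec. field. }
assert (Hw2 : (2 - RtoC w)%C <> 0%C).
{ apply Rabs_def2 in Hw. apply Cneq_0_Re. simpl. lra. }
assert (Es : s = (2 * y / (2 - RtoC w))%C).
{ replace y with (y + (s + - (1) * y + - (1 / 2) * (RtoC w * s)))%C by (rewrite E2; ring).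
  field. exact Hw2. }
rewrite <- E1, Es. field. exact Hw2.
Qed.

Lemma frob_sol_0 (lambda : C) : frob_sol lambda 0 = (4 * lambda)%C.
Proof.
unfold frob_sol, CPSeries. rewrite !PSeries_0. now destruct lambda.
Qed.

Lemma frob_sol'_0 (lambda : C) :
  frob_sol' lambda 0 = (lambda * lambda + 5 * lambda + 2)%C.
Proof.
unfold frob_sol', CPSeries. rewrite !PSeries_0.
transitivity (CPS_derive (frob_coef lambda) 0);
  [now destruct (CPS_derive (frob_coef lambda) 0)|].
unfold CPS_derive. simpl. ring.
Qed.

(** The bound of [frob_lower] is summed against [w^n >= 0]: the coefficients [n + 1] and [1]
    generate [1/(1-w)^2] and [1/(1-w)]. Since [1 - w = rho^2], the leading term is [rho^(-4)]. *)
Lemma frob_sol_lower (lambda : C) : 0 <= Re lambda ->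
  exists c D : R, 0 < c /\
    forall w, 0 <= w < 1 ->
      c * / (1 - w) ^ 2 - D * / (1 - w) <= Cmod (frob_sol lambda w).
Proof.
intros Hl. destruct (frob_lower lambda Hl) as [Q [d [D [Hd HQ]]]].
assert (HQ0 : 0 < Cmod Q + 1) by (generalize (Cmod_ge_0 Q); lra).
(* The added 1 makes the divisor positive whatever [Q] is. *)
exists (d / (Cmod Q + 1)), (D / (Cmod Q + 1)).
split; [apply Rdiv_lt_0_compat; assumption|]. intros w Hw.
assert (Hw' : Rabs w < 1) by (rewrite Rabs_pos_eq; lra).
destruct (is_Cpseries_scal Q _ _ _ (CPSeries_correct _ w (frob_converges lambda Hl) Hw'))
  as [HP _].
fold (frob_sol lambda w) in HP.
assert (HG := is_pseries_minus _ _ _ _ _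
  (is_pseries_scal d _ w _ (Rmult_comm _ _) (is_pseries_geom_derive w Hw'))
  (is_pseries_scal D _ w _ (Rmult_comm _ _) (is_pseries_geom w Hw'))).
assert (Hle : d * / (1 - w) ^ 2 - D * / (1 - w) <= Re (Q * frob_sol lambda w)%C).
{ apply Rminus_le_0.
  refine (is_pseries_nonneg _ w _ (proj1 Hw) _ (is_pseries_minus _ _ _ _ _ HP HG)).
  intros n. specialize (HQ n).
  change (0 <= Re (Q * frob_coef lambda n)%C - (d * (INR n + 1) - D * 1)). lra. }
apply (Rmult_le_reg_l (Cmod Q + 1)); [exact HQ0|].
replace ((Cmod Q + 1) * (d / (Cmod Q + 1) * / (1 - w) ^ 2 - D / (Cmod Q + 1) * / (1 - w)))
  with (d * / (1 - w) ^ 2 - D * / (1 - w)) by (field; lra).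
assert (T := re_le_Cmod (Q * frob_sol lambda w)%C). rewrite Cmod_mult in T.
generalize (Rle_abs (Re (Q * frob_sol lambda w)%C)) (Cmod_ge_0 (frob_sol lambda w)). lra.
Qed.

(** * Differentiation rules *)

Lemma is_Cderive_eq (f : R -> C) (x : R) (l l' : C) :
  l = l' -> is_Cderive f x l -> is_Cderive f x l'.
Proof. now intros <-. Qed.

Lemma is_Cderive_plus (f g : R -> C) (x : R) (lf lg : C) :
  is_Cderive f x lf -> is_Cderive g x lg ->
  is_Cderive (fun t => f t + g t)%C x (lf + lg)%C.
Proof.
intros [F1 F2] [G1 G2].
split; [exact (is_derive_plus _ _ _ _ _ F1 G1) | exact (is_derive_plus _ _ _ _ _ F2 G2)].
Qed.

Lemma is_Cderive_minus (f g : R -> C) (x : R) (lf lg : C) :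
  is_Cderive f x lf -> is_Cderive g x lg ->
  is_Cderive (fun t => f t - g t)%C x (lf - lg)%C.
Proof.
intros [F1 F2] [G1 G2].
split; [exact (is_derive_minus _ _ _ _ _ F1 G1) | exact (is_derive_minus _ _ _ _ _ F2 G2)].
Qed.

Lemma is_Cderive_mult (f g : R -> C) (x : R) (lf lg : C) :
  is_Cderive f x lf -> is_Cderive g x lg ->
  is_Cderive (fun t => f t * g t)%C x (lf * g x + f x * lg)%C.
Proof.
intros [F1 F2] [G1 G2].
assert (M : forall (p q : R -> R) lp lq, is_derive p x lp -> is_derive q x lq ->
  is_derive (fun t => p t * q t) x (lp * q x + p x * lq)).
{ intros p q lp lq Hp Hq. exact (is_derive_mult p q x lp lq Hp Hq Rmult_comm). }
split.
- replace (Re (lf * g x + f x * lg)%C)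
    with ((Re lf * Re (g x) + Re (f x) * Re lg) - (Im lf * Im (g x) + Im (f x) * Im lg))
    by (unfold Re, Im; simpl; ring).
  exact (is_derive_minus _ _ _ _ _ (M _ _ _ _ F1 G1) (M _ _ _ _ F2 G2)).
- replace (Im (lf * g x + f x * lg)%C)
    with ((Re lf * Im (g x) + Re (f x) * Im lg) + (Im lf * Re (g x) + Im (f x) * Re lg))
    by (unfold Re, Im; simpl; ring).
  exact (is_derive_plus _ _ _ _ _ (M _ _ _ _ F1 G2) (M _ _ _ _ F2 G1)).
Qed.

Lemma is_Cderive_const (c : C) (x : R) : is_Cderive (fun _ => c) x 0%C.
Proof. split; exact (is_derive_const _ _). Qed.

Lemma is_Cderive_RtoC (h : R -> R) (x l : R) :
  is_derive h x l -> is_Cderive (fun t => RtoC (h t)) x (RtoC l).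
Proof. intros H. split; [exact H | exact (is_derive_const _ _)]. Qed.

Lemma is_Cderive_comp (f : R -> C) (h : R -> R) (x l : R) (lf : C) :
  is_Cderive f (h x) lf -> is_derive h x l ->
  is_Cderive (fun t => f (h t)) x (RtoC l * lf)%C.
Proof.
intros [F1 F2] H. split.
- replace (Re (RtoC l * lf)%C) with (l * Re lf) by (unfold Re; simpl; ring).
  exact (is_derive_comp (fun t => Re (f t)) h x _ _ F1 H).
- replace (Im (RtoC l * lf)%C) with (l * Im lf) by (unfold Im; simpl; ring).
  exact (is_derive_comp (fun t => Im (f t)) h x _ _ F2 H).
Qed.

(** * The Darboux transformation *)

(** The values of [u], [u'], [u''] are free arguments, so the mode equation becomes an algebraic
    relation that can also be passed to the limit at [rho = 1]. *)
Definition ode_lhs (lambda : C) (rho : R) (u0 u1 u2 : C) : C :=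
  (- RtoC (1 - rho ^ 2)%R * u2
   - RtoC (2 * ((1 - rho ^ 2) / rho))%R * u1
   + 2 * lambda * RtoC rho * u1
   + lambda * (lambda + 1) * u0
   + RtoC (V rho / rho ^ 2)%R * u0)%C.

Definition ode (lambda : C) (rho : R) (u0 u1 u2 : C) : Prop :=
  ode_lhs lambda rho u0 u1 u2 = 0%C.

(** The quotient [(1 - rho^2) / (rho (1 + rho^2))] is the logarithmic derivative of the symmetry
    mode, so for [lambda = 1] this operator annihilates that mode. *)
Definition susy (lambda : C) (rho : R) (u0 u1 : C) : C :=
  (RtoC ((1 - rho ^ 2) / rho ^ 2)%R * u1
   - (RtoC ((1 - rho ^ 2) ^ 2 / (rho ^ 3 * (1 + rho ^ 2)))%R
      + (lambda - 1) * RtoC (/ rho)) * u0)%C.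

(** The [rho]-derivative of [susy], with [u''] eliminated by means of the mode
    equation, so that no division by [1 - rho^2] occurs. *)
Definition susy' (lambda : C) (rho : R) (u0 u1 : C) : C :=
  ((RtoC (- (4) / rho ^ 3 + 3 / rho - (1 - rho ^ 2) ^ 2 / (rho ^ 3 * (1 + rho ^ 2)))%R
    + lambda * RtoC (/ rho)) * u1
   + (RtoC ((5 - 9 * rho ^ 2 - 5 * rho ^ 4 + rho ^ 6) / (rho ^ 4 * (1 + rho ^ 2) ^ 2))%R
      + (lambda * lambda + 2 * lambda - 1) * RtoC (/ rho ^ 2)) * u0)%C.

Ltac nonzero :=
  apply Rgt_not_eq; unfold Rgt;
  repeat (apply Rmult_lt_0_compat || apply pow_lt); nra.

Ltac push_RtoC :=
  repeat first
    [ rewrite RtoC_div by nonzero | rewrite RtoC_inv by nonzero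
    | rewrite RtoC_plus | rewrite RtoC_minus | rewrite RtoC_opp
    | rewrite RtoC_mult | rewrite RtoC_pow ].

Lemma unit_interval_neq_0 (rho : R) : 0 < rho < 1 ->
  RtoC rho <> 0%C /\ (1 - RtoC rho * RtoC rho)%C <> 0%C
  /\ (1 + RtoC rho * RtoC rho)%C <> 0%C.
Proof. intros H. repeat split; apply Cneq_0_Re; simpl; nra. Qed.

Lemma ode_solved (lambda : C) (rho : R) (u0 u1 u2 : C) : 0 < rho < 1 ->
  ode lambda rho u0 u1 u2 ->
  (u2 = (- (2 * (1 - RtoC rho ^ 2) / RtoC rho) * u1 + 2 * lambda * RtoC rho * u1
    + lambda * (lambda + 1) * u0
    + 2 * (1 - 6 * RtoC rho ^ 2 + RtoC rho ^ 4) / ((1 + RtoC rho ^ 2) ^ 2 * RtoC rho ^ 2)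
      * u0) / (1 - RtoC rho ^ 2))%C.
Proof.
intros Hrho E. destruct (unit_interval_neq_0 rho Hrho) as [N1 [N2 N3]].
unfold ode, ode_lhs in E. rewrite V_rational in E.
revert E. push_RtoC. intros E.
(* The left side [L] is 0 and contains [u2] with coefficient [-(1 - rho^2)], so adding
   [L / (1 - rho^2)] eliminates [u2]. *)
match type of E with (?L = _)%C =>
  replace u2 with (u2 + L / (1 - RtoC rho ^ 2))%C
    by (rewrite E; field; simpl; rewrite ?Cmult_1_r; assumption) end.
simpl. field. repeat split; assumption.
Qed.

Lemma is_Cderive_susy (lambda : C) (rho : R) (u0 u1 : R -> C) (u2 : C) :
  0 < rho < 1 ->
  is_Cderive u0 rho (u1 rho) -> is_Cderive u1 rho u2 ->
  ode lambda rho (u0 rho) (u1 rho) u2 ->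
  is_Cderive (fun t => susy lambda t (u0 t) (u1 t)) rho (susy' lambda rho (u0 rho) (u1 rho)).
Proof.
intros Hrho H0 H1 E. apply ode_solved in E; [|exact Hrho].
destruct (unit_interval_neq_0 rho Hrho) as [N1 [N2 N3]].
eapply is_Cderive_eq; cycle 1.
- unfold susy.
  apply is_Cderive_minus; apply is_Cderive_mult; try eassumption.
  + apply is_Cderive_RtoC. auto_derive; [nonzero | reflexivity].
  + apply is_Cderive_plus.
    * apply is_Cderive_RtoC. auto_derive; [nonzero | reflexivity].
    * apply is_Cderive_mult; [apply is_Cderive_const|].
      apply is_Cderive_RtoC. auto_derive; [nonzero | reflexivity].
- cbv beta. rewrite E. unfold susy'. push_RtoC. simpl. field.
  repeat split; assumption.
Qed.

(** As [susy'] involves only [u] and [u'], its derivative calls for no third derivative of [u]; the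
    equation is then a rational identity once [u''] is eliminated. *)
Lemma susy_equation (lambda : C) (rho : R) (u0 u1 : R -> C) (u2 : C) :
  0 < rho < 1 ->
  is_Cderive u0 rho (u1 rho) -> is_Cderive u1 rho u2 ->
  ode lambda rho (u0 rho) (u1 rho) u2 ->
  exists y2,
    is_Cderive (fun t => susy' lambda t (u0 t) (u1 t)) rho y2 /\
    ((1 - RtoC rho ^ 2) * y2
     + (6 / RtoC rho - 2 * (lambda + 3) * RtoC rho) * susy' lambda rho (u0 rho) (u1 rho)
     - ((lambda + 2) * (lambda + 3) - 8 / (1 + RtoC rho ^ 2))
         * susy lambda rho (u0 rho) (u1 rho) = 0)%C.
Proof.
intros Hrho H0 H1 E. apply ode_solved in E; [|exact Hrho].
destruct (unit_interval_neq_0 rho Hrho) as [N1 [N2 N3]].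
eexists. split.
- unfold susy'.
  apply is_Cderive_plus; apply is_Cderive_mult; try eassumption.
  + apply is_Cderive_plus.
    * apply is_Cderive_RtoC. auto_derive; [repeat split; nonzero | reflexivity].
    * apply is_Cderive_mult; [apply is_Cderive_const|].
      apply is_Cderive_RtoC. auto_derive; [nonzero | reflexivity].
  + apply is_Cderive_plus.
    * apply is_Cderive_RtoC. auto_derive; [nonzero | reflexivity].
    * apply is_Cderive_mult; [apply is_Cderive_const|].
      apply is_Cderive_RtoC. auto_derive; [nonzero | reflexivity].
- rewrite E. unfold susy, susy'. push_RtoC. simpl. field.
  repeat split; assumption.
Qed.

(** * The Wronskian *)

Definition frob_rho (lambda : C) (rho : R) : C := frob_sol lambda (1 - rho ^ 2).
Definition frob_rho' (lambda : C) (rho : R) : C :=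
  (RtoC (- (2) * rho) * frob_sol' lambda (1 - rho ^ 2))%C.

Lemma Rabs_1_minus_sqr (rho : R) : 0 < rho <= 1 -> Rabs (1 - rho ^ 2) < 1.
Proof. intros H. apply Rabs_def1; nra. Qed.

(** The light cone [rho = 1] is included: it is [w = 0], the centre of the disk of convergence. *)
Lemma is_Cderive_frob_rho (lambda : C) (rho : R) : 0 <= Re lambda -> 0 < rho <= 1 ->
  is_Cderive (frob_rho lambda) rho (frob_rho' lambda rho).
Proof.
intros Hl Hr. unfold frob_rho, frob_rho'.
apply is_Cderive_comp.
- apply is_Cderive_CPSeries; [apply frob_converges, Hl | apply Rabs_1_minus_sqr, Hr].
- auto_derive; [trivial | ring].
Qed.

Lemma is_Cderive_frob_rho' (lambda : C) (rho : R) : 0 <= Re lambda -> 0 < rho <= 1 ->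
  is_Cderive (frob_rho' lambda) rho
    (4 * RtoC rho ^ 2 * frob_sol'' lambda (1 - rho ^ 2)
     - 2 * frob_sol' lambda (1 - rho ^ 2))%C.
Proof.
intros Hl Hr. unfold frob_rho'.
eapply is_Cderive_eq; cycle 1.
- apply is_Cderive_mult.
  + apply is_Cderive_RtoC. auto_derive; [trivial | reflexivity].
  + apply is_Cderive_comp.
    * apply is_Cderive_CPSeries; [|apply Rabs_1_minus_sqr, Hr].
      apply converges_in_disk_derive, frob_converges, Hl.
    * auto_derive; [trivial | reflexivity].
- fold (frob_sol' lambda) (frob_sol'' lambda). push_RtoC. simpl. ring.
Qed.

Lemma frob_rho_equation (lambda : C) (rho : R) : 0 <= Re lambda -> 0 < rho < 1 ->
  ((1 - RtoC rho ^ 2) * (4 * RtoC rho ^ 2 * frob_sol'' lambda (1 - rho ^ 2)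
     - 2 * frob_sol' lambda (1 - rho ^ 2))
   + (6 / RtoC rho - 2 * (lambda + 3) * RtoC rho) * frob_rho' lambda rho
   - ((lambda + 2) * (lambda + 3) - 8 / (1 + RtoC rho ^ 2)) * frob_rho lambda rho = 0)%C.
Proof.
intros Hl Hr. destruct (unit_interval_neq_0 rho Hr) as [N1 [N2 N3]].
rewrite <- (frob_sol_equation lambda (1 - rho ^ 2) Hl) by (apply Rabs_1_minus_sqr; lra).
unfold frob_rho, frob_rho'. push_RtoC. simpl. field.
repeat split; try assumption; apply Cneq_0_Re; simpl; nra.
Qed.

Lemma is_derive_Cmod_sqr (f : R -> C) (x : R) (l : C) :
  is_Cderive f x l ->
  is_derive (fun t => Re (f t) ^ 2 + Im (f t) ^ 2) x
    (2 * (Re (f x) * Re l + Im (f x) * Im l)).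
Proof.
intros [H1 H2].
replace (2 * (Re (f x) * Re l + Im (f x) * Im l))
  with (INR 2 * Re l * Re (f x) ^ 1 + INR 2 * Im l * Im (f x) ^ 1) by (simpl; ring).
exact (is_derive_plus _ _ _ _ _ (is_derive_pow _ 2 _ _ H1) (is_derive_pow _ 2 _ _ H2)).
Qed.

Lemma increment_nonneg (f df : R -> R) (a b : R) : a <= b ->
  (forall x, a <= x <= b -> is_derive f x (df x)) ->
  (forall x, a <= x <= b -> 0 <= df x) -> f a <= f b.
Proof.
intros Hab Hd Hp.
destruct (MVT_gen f a b df) as [c [Hc E]].
- intros x Hx. apply Hd. rewrite Rmin_left, Rmax_right in Hx; lra.
- intros x Hx. apply continuity_pt_filterlim, (ex_derive_continuous f).
  exists (df x). apply Hd. rewrite Rmin_left, Rmax_right in Hx; lra.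
- rewrite Rmin_left, Rmax_right in Hc by lra.
  assert (0 <= df c * (b - a)) by (apply Rmult_le_pos; [apply Hp; lra | lra]). lra.
Qed.

Lemma is_Cderive_0_constant (f : R -> C) (a b : R) : a <= b ->
  (forall x, a <= x <= b -> is_Cderive f x 0%C) -> f a = f b.
Proof.
intros Hab Hd.
assert (K : forall h : R -> R, (forall x, a <= x <= b -> is_derive h x 0) -> h a = h b).
{ intros h Hh. apply Rle_antisym.
  - apply (increment_nonneg h (fun _ => 0)); [exact Hab | exact Hh | intros; lra].
  - apply Ropp_le_cancel.
    apply (increment_nonneg (fun x => - h x) (fun _ => - 0));
      [exact Hab | | intros; lra].
    intros x Hx. exact (is_derive_opp _ _ _ (Hh x Hx)). }
rewrite (surjective_pairing (f a)), (surjective_pairing (f b)).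
f_equal; [apply (K (fun t => Re (f t))) | apply (K (fun t => Im (f t)))];
  intros x Hx; apply (Hd x Hx).
Qed.

Lemma nondecreasing_limit_0 (f df : R -> R) :
  (forall x, 0 < x < 1 -> is_derive f x (df x)) ->
  (forall x, 0 < x < 1 -> 0 <= df x) ->
  (forall x, 0 < x < 1 -> 0 <= f x) ->
  filterlim f (at_left 1) (locally 0) ->
  forall x, 0 < x < 1 -> f x = 0.
Proof.
intros Hd Hp H0 Hlim x Hx.
destruct (Rle_lt_or_eq_dec _ _ (H0 x Hx)) as [Hpos|E]; [exfalso | now symmetry].
destruct (Hlim (fun z => z < f x)) as [eps He].
- exists (mkposreal _ Hpos). intros z Hz.
  assert (Hz' : Rabs (z - 0) < f x) by exact Hz. apply Rabs_def2 in Hz'. lra.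
- assert (Heps := cond_pos eps).
  set (z := Rmax ((1 + x) / 2) (1 - eps / 2)).
  assert (Hz1 := Rmax_l ((1 + x) / 2) (1 - eps / 2)).
  assert (Hz2 := Rmax_r ((1 + x) / 2) (1 - eps / 2)). fold z in Hz1, Hz2.
  assert (Hz3 : z < 1) by (apply Rmax_lub_lt; lra).
  assert (Hlt : f z < f x).
  { apply He; [|exact Hz3]. change (Rabs (z - 1) < eps). apply Rabs_def1; lra. }
  assert (f x <= f z); [|lra].
  apply (increment_nonneg f df); [lra | |]; intros t Ht; [apply Hd | apply Hp]; lra.
Qed.

(** Abel's formula: [W' = (-6/rho + 2 lambda rho / (1 - rho^2)) W]. The weight [rho^12] cancels the
    first term in the derivative of [|W|^2], and the remaining rate has the sign of [Re lambda]. *)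
Lemma wronskian_monotone (lambda : C) (y y1 z z1 : R -> C) (y2 z2 : C) (rho : R) :
  0 <= Re lambda -> 0 < rho < 1 ->
  is_Cderive y rho (y1 rho) -> is_Cderive y1 rho y2 ->
  is_Cderive z rho (z1 rho) -> is_Cderive z1 rho z2 ->
  ((1 - RtoC rho ^ 2) * y2
   + (6 / RtoC rho - 2 * (lambda + 3) * RtoC rho) * y1 rho
   - ((lambda + 2) * (lambda + 3) - 8 / (1 + RtoC rho ^ 2)) * y rho = 0)%C ->
  ((1 - RtoC rho ^ 2) * z2
   + (6 / RtoC rho - 2 * (lambda + 3) * RtoC rho) * z1 rho
   - ((lambda + 2) * (lambda + 3) - 8 / (1 + RtoC rho ^ 2)) * z rho = 0)%C ->
  let W t := (y t * z1 t - y1 t * z t)%C in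
  is_derive (fun t => t ^ 12 * (Re (W t) ^ 2 + Im (W t) ^ 2)) rho
    (4 * Re lambda * rho / (1 - rho ^ 2) * (rho ^ 12 * (Re (W rho) ^ 2 + Im (W rho) ^ 2))).
Proof.
intros Hl Hr Hy Hy1 Hz Hz1 Ey Ez W.
destruct (unit_interval_neq_0 rho Hr) as [N1 [N2 N3]].
assert (HW : is_Cderive W rho ((RtoC (6 * rho / (1 - rho ^ 2) - 6 / (rho * (1 - rho ^ 2)))%R
   + lambda * RtoC (2 * rho / (1 - rho ^ 2))%R) * W rho)%C).
{ eapply is_Cderive_eq; cycle 1.
  - unfold W. apply is_Cderive_minus; apply is_Cderive_mult; eassumption.
  - cbv beta.
    (* Cross-multiplying the two equations by [z] and [y] and subtracting removes both second
       derivatives. *)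
    match type of Ey with (?L = _)%C => match type of Ez with (?M = _)%C =>
      transitivity ((y rho * z2 - y2 * z rho
        + (z rho * L - y rho * M) / (1 - RtoC rho ^ 2))%C) end end.
    + rewrite Ey, Ez. field. simpl. rewrite Cmult_1_r. assumption.
    + unfold W. push_RtoC. simpl. field. repeat split; assumption. }
apply is_derive_Cmod_sqr in HW.
assert (HP : is_derive (fun t => t ^ 12) rho (12 * rho ^ 11))
  by (auto_derive; [trivial | simpl; ring]).
assert (H := is_derive_mult _ _ _ _ _ HP HW Rmult_comm).
match type of H with is_derive _ _ ?l => replace (_ * _ / _ * _) with l; [exact H|] end.
revert H. generalize (W rho). intros w _.
destruct lambda as [a b], w as [p q]. unfold Re, Im, plus, mult; simpl.
field. nra.
Qed.

(** * Boundary values at the light cone *)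

Definition is_Climit (F : (R -> Prop) -> Prop) (f : R -> C) (l : C) : Prop :=
  filterlim (fun t => Re (f t)) F (locally (Re l)) /\
  filterlim (fun t => Im (f t)) F (locally (Im l)).

Lemma filterlim_Rplus_gen {F : (R -> Prop) -> Prop} {FF : Filter F} (f g : R -> R) (a b : R) :
  filterlim f F (locally a) -> filterlim g F (locally b) ->
  filterlim (fun t => f t + g t) F (locally (a + b)).
Proof.
intros Hf Hg. eapply filterlim_comp_2; [exact Hf | exact Hg |].
exact (filterlim_plus (V := R_NormedModule) a b).
Qed.

Lemma filterlim_Rmult_gen {F : (R -> Prop) -> Prop} {FF : Filter F} (f g : R -> R) (a b : R) :
  filterlim f F (locally a) -> filterlim g F (locally b) ->
  filterlim (fun t => f t * g t) F (locally (a * b)).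
Proof.
intros Hf Hg. eapply filterlim_comp_2; [exact Hf | exact Hg |].
exact (filterlim_mult (K := R_AbsRing) a b).
Qed.

Lemma filterlim_Ropp_gen {F : (R -> Prop) -> Prop} {FF : Filter F} (f : R -> R) (a : R) :
  filterlim f F (locally a) -> filterlim (fun t => - f t) F (locally (- a)).
Proof.
intros Hf. eapply filterlim_comp; [exact Hf |].
exact (filterlim_opp (V := R_NormedModule) a).
Qed.

Section Climit.

Context {F : (R -> Prop) -> Prop} {FF : ProperFilter F}.

Lemma is_Climit_const (c : C) : is_Climit F (fun _ => c) c.
Proof. split; apply filterlim_const. Qed.

Lemma is_Climit_RtoC (h : R -> R) (l : R) :
  filterlim h F (locally l) -> is_Climit F (fun t => RtoC (h t)) (RtoC l).
Proof. intros H. split; [exact H | apply filterlim_const]. Qed.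

Lemma is_Climit_plus (f g : R -> C) (a b : C) :
  is_Climit F f a -> is_Climit F g b -> is_Climit F (fun t => f t + g t)%C (a + b)%C.
Proof.
intros [F1 F2] [G1 G2].
split; [exact (filterlim_Rplus_gen _ _ _ _ F1 G1) | exact (filterlim_Rplus_gen _ _ _ _ F2 G2)].
Qed.

Lemma is_Climit_opp (f : R -> C) (a : C) :
  is_Climit F f a -> is_Climit F (fun t => - f t)%C (- a)%C.
Proof.
intros [F1 F2].
split; [exact (filterlim_Ropp_gen _ _ F1) | exact (filterlim_Ropp_gen _ _ F2)].
Qed.

Lemma is_Climit_minus (f g : R -> C) (a b : C) :
  is_Climit F f a -> is_Climit F g b -> is_Climit F (fun t => f t - g t)%C (a - b)%C.
Proof. intros Hf Hg. apply is_Climit_plus, is_Climit_opp; assumption. Qed.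

Lemma is_Climit_mult (f g : R -> C) (a b : C) :
  is_Climit F f a -> is_Climit F g b -> is_Climit F (fun t => f t * g t)%C (a * b)%C.
Proof.
intros [F1 F2] [G1 G2]. split.
- exact (filterlim_Rplus_gen _ _ _ _ (filterlim_Rmult_gen _ _ _ _ F1 G1)
    (filterlim_Ropp_gen _ _ (filterlim_Rmult_gen _ _ _ _ F2 G2))).
- exact (filterlim_Rplus_gen _ _ _ _ (filterlim_Rmult_gen _ _ _ _ F1 G2)
    (filterlim_Rmult_gen _ _ _ _ F2 G1)).
Qed.

Lemma is_Climit_eventually_0 (f : R -> C) (l : C) :
  F (fun t => f t = 0%C) -> is_Climit F f l -> l = 0%C.
Proof.
intros H0 [H1 H2].
assert (U : forall (h : R -> R) s, F (fun t => h t = 0) -> filterlim h F (locally s) -> s = 0).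
{ intros h s Hh Hs. apply (filterlim_locally_unique h s 0 Hs).
  apply (filterlim_ext_loc (fun _ => 0)); [|apply filterlim_const].
  revert Hh. apply filter_imp. intros t E. now symmetry. }
destruct l as [a b].
apply U in H1; [|revert H0; apply filter_imp; intros t E; now rewrite E].
apply U in H2; [|revert H0; apply filter_imp; intros t E; now rewrite E].
simpl in H1, H2. now rewrite H1, H2.
Qed.

Lemma is_Climit_Cmod_bounded (f : R -> C) (l : C) :
  is_Climit F f l -> exists K, F (fun t => Cmod (f t) <= K).
Proof.
intros [H1 H2]. exists (Rabs (Re l) + 1 + (Rabs (Im l) + 1)).
assert (B : forall (h : R -> R) s, filterlim h F (locally s) ->
  F (fun t => Rabs (h t) <= Rabs s + 1)).
{ intros h s Hs. apply (Hs (fun z => Rabs z <= Rabs s + 1)).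
  exists (mkposreal 1 Rlt_0_1). intros z Hz. assert (Hz' : Rabs (z - s) < 1) by exact Hz.
  generalize (Rabs_triang_inv z s). lra. }
generalize (filter_and _ _ (B _ _ H1) (B _ _ H2)). apply filter_imp.
intros t [B1 B2].
replace (f t) with (RtoC (Re (f t)) + Ci * RtoC (Im (f t)))%C
  by (destruct (f t); unfold Ci, RtoC, Cplus, Cmult; simpl; f_equal; ring).
eapply Rle_trans; [apply Cmod_triangle|].
rewrite Cmod_mult, Cmod_Ci, !Cmod_R. lra.
Qed.

End Climit.

Lemma filterlim_at_left_continuous (h : R -> R) (x : R) :
  ex_derive h x -> filterlim h (at_left x) (locally (h x)).
Proof.
intros H. eapply filterlim_filter_le_1; [|exact (ex_derive_continuous h x H)].
apply filter_le_within.
Qed.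

Lemma is_Climit_at_left_derive (f : R -> C) (x : R) (l : C) :
  is_Cderive f x l -> is_Climit (at_left x) f (f x).
Proof.
intros [H1 H2]. split.
- apply (filterlim_at_left_continuous (fun t => Re (f t))). now exists (Re l).
- apply (filterlim_at_left_continuous (fun t => Im (f t))). now exists (Im l).
Qed.

Lemma at_left_1_interval : at_left 1 (fun t => 0 < t < 1).
Proof.
exists (mkposreal 1 Rlt_0_1). intros t Ht Ht1.
assert (Ht' : Rabs (t - 1) < 1) by exact Ht. apply Rabs_def2 in Ht'. lra.
Qed.

Lemma at_right_0_interval : at_right 0 (fun t => 0 < t < 1).
Proof.
exists (mkposreal 1 Rlt_0_1). intros t Ht Ht1.
assert (Ht' : Rabs (t - 0) < 1) by exact Ht. apply Rabs_def2 in Ht'. lra.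
Qed.

(** Descends along the ring operations; [HR] supplies the limits of the real coefficients. *)
Ltac climit HR :=
  lazymatch goal with
  | |- is_Climit _ (fun t => (_ + _)%C) _ => apply is_Climit_plus; climit HR
  | |- is_Climit _ (fun t => (_ - _)%C) _ => apply is_Climit_minus; climit HR
  | |- is_Climit _ (fun t => (_ * _)%C) _ => apply is_Climit_mult; climit HR
  | |- is_Climit _ (fun t => (- _)%C) _ => apply is_Climit_opp; climit HR
  | |- is_Climit _ RtoC _ =>
      apply (HR (fun t => t)); auto_derive; exact I
  | |- is_Climit _ (fun t => RtoC (@?h t)) _ =>
      first [apply is_Climit_const | apply (HR h); unfold V; auto_derive; lra || exact I]
  | |- _ => first [eassumption | apply is_Climit_const]
  end.

(** The boundary value of the Wronskian is [-2 (lambda - 1)] times the left side of the mode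
    equation at [rho = 1]. That equation holds there by continuity. *)
Lemma wronskian_limit (lambda : C) (u0 u1 u2 : R -> C) : 0 <= Re lambda ->
  (forall rho, 0 < rho < 1 -> ode lambda rho (u0 rho) (u1 rho) (u2 rho)) ->
  is_Climit (at_left 1) u0 (u0 1) -> is_Climit (at_left 1) u1 (u1 1) ->
  is_Climit (at_left 1) u2 (u2 1) ->
  is_Climit (at_left 1)
    (fun t => susy lambda t (u0 t) (u1 t) * frob_rho' lambda t
              - susy' lambda t (u0 t) (u1 t) * frob_rho lambda t)%C 0%C.
Proof.
intros Hl Hode L0 L1 L2.
assert (HR : forall h : R -> R, ex_derive h 1 ->
  is_Climit (at_left 1) (fun t => RtoC (h t)) (RtoC (h 1)))
  by (intros h Hh; apply is_Climit_RtoC, filterlim_at_left_continuous, Hh).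
assert (E1 : ode lambda 1 (u0 1) (u1 1) (u2 1)).
{ apply (is_Climit_eventually_0 (F := at_left 1)
    (fun t => ode_lhs lambda t (u0 t) (u1 t) (u2 t))).
  - generalize at_left_1_interval. apply filter_imp. exact Hode.
  - unfold ode_lhs. climit HR. }
assert (D0 := is_Cderive_frob_rho lambda 1 Hl ltac:(lra)).
assert (D1 := is_Cderive_frob_rho' lambda 1 Hl ltac:(lra)).
apply is_Climit_at_left_derive in D0, D1.
replace (RtoC 0) with (susy lambda 1 (u0 1) (u1 1) * frob_rho' lambda 1
              - susy' lambda 1 (u0 1) (u1 1) * frob_rho lambda 1)%C.
- unfold susy, susy'. climit HR.
- unfold frob_rho, frob_rho'. replace (1 - 1 ^ 2) with 0 by ring.
  rewrite frob_sol_0, frob_sol'_0.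
  (* At [rho = 1] the terms with [1 - rho^2] drop out and the potential equals -2, leaving a
     first-order boundary condition. *)
  assert (E2 : (2 * lambda * u1 1 + (lambda * (lambda + 1) - 2) * u0 1 = 0)%C).
  { rewrite <- E1. unfold ode_lhs. rewrite V_rational.
    replace (2 * (1 - 6 * 1 ^ 2 + 1 ^ 4) / (1 + 1 ^ 2) ^ 2 / 1 ^ 2) with (- (2)) by field.
    replace (2 * ((1 - 1 ^ 2) / 1)) with 0 by field.
    replace (1 - 1 ^ 2) with 0 by ring. rewrite RtoC_opp. ring. }
  unfold susy, susy'.
  replace ((1 - 1 ^ 2) / 1 ^ 2) with 0 by field.
  replace ((1 - 1 ^ 2) ^ 2 / (1 ^ 3 * (1 + 1 ^ 2))) with 0 by field.
  replace (- (4) / 1 ^ 3 + 3 / 1 - 0) with (- (1)) by field.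
  replace ((5 - 9 * 1 ^ 2 - 5 * 1 ^ 4 + 1 ^ 6) / (1 ^ 4 * (1 + 1 ^ 2) ^ 2)) with (- (2)) by field.
  replace (/ 1 ^ 2) with 1 by field. replace (/ 1) with 1 by field.
  rewrite !RtoC_mult, !RtoC_opp.
  transitivity (- (2) * (lambda - 1) * (2 * lambda * u1 1 + (lambda * (lambda + 1) - 2) * u0 1))%C.
  + ring.
  + rewrite E2. ring.
Qed.

Lemma wronskian_zero (lambda : C) (u0 u1 u2 : R -> C) : 0 <= Re lambda ->
  (forall rho, 0 < rho < 1 -> is_Cderive u0 rho (u1 rho)) ->
  (forall rho, 0 < rho < 1 -> is_Cderive u1 rho (u2 rho)) ->
  (forall rho, 0 < rho < 1 -> ode lambda rho (u0 rho) (u1 rho) (u2 rho)) ->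
  is_Climit (at_left 1) u0 (u0 1) -> is_Climit (at_left 1) u1 (u1 1) ->
  is_Climit (at_left 1) u2 (u2 1) ->
  forall rho, 0 < rho < 1 ->
    (susy lambda rho (u0 rho) (u1 rho) * frob_rho' lambda rho
     - susy' lambda rho (u0 rho) (u1 rho) * frob_rho lambda rho = 0)%C.
Proof.
intros Hl H0 H1 Hode L0 L1 L2 rho Hr.
assert (LW := wronskian_limit lambda u0 u1 u2 Hl Hode L0 L1 L2).
set (W := fun t => (susy lambda t (u0 t) (u1 t) * frob_rho' lambda t
              - susy' lambda t (u0 t) (u1 t) * frob_rho lambda t)%C) in *.
change (W rho = 0%C).
assert (Hpos : forall t, 0 < t < 1 -> 0 <= t ^ 12 * (Re (W t) ^ 2 + Im (W t) ^ 2)).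
{ intros t Ht. apply Rmult_le_pos; [apply pow_le; lra|].
  apply Rplus_le_le_0_compat; apply pow2_ge_0. }
assert (Z : rho ^ 12 * (Re (W rho) ^ 2 + Im (W rho) ^ 2) = 0).
{ refine (nondecreasing_limit_0 (fun t => t ^ 12 * (Re (W t) ^ 2 + Im (W t) ^ 2))
    (fun t => 4 * Re lambda * t / (1 - t ^ 2) * (t ^ 12 * (Re (W t) ^ 2 + Im (W t) ^ 2)))
    _ _ Hpos _ rho Hr).
  - intros t Ht.
    destruct (susy_equation lambda t u0 u1 (u2 t) Ht (H0 t Ht) (H1 t Ht) (Hode t Ht))
      as [y2 [Dy Ey]].
    apply (wronskian_monotone lambda (fun t => susy lambda t (u0 t) (u1 t))
      (fun t => susy' lambda t (u0 t) (u1 t)) (frob_rho lambda) (frob_rho' lambda) y2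
      (4 * RtoC t ^ 2 * frob_sol'' lambda (1 - t ^ 2) - 2 * frob_sol' lambda (1 - t ^ 2)));
      try assumption.
    + apply (is_Cderive_susy lambda t u0 u1 (u2 t)); auto.
    + apply is_Cderive_frob_rho; [exact Hl | lra].
    + apply is_Cderive_frob_rho'; [exact Hl | lra].
    + apply frob_rho_equation; assumption.
  - intros t Ht. apply Rmult_le_pos; [|apply Hpos, Ht].
    apply Rmult_le_pos; [repeat apply Rmult_le_pos; lra|].
    left. apply Rinv_0_lt_compat. nra.
  - destruct LW as [LR LI].
    assert (LP := filterlim_at_left_continuous (fun t => t ^ 12) 1
      ltac:(auto_derive; trivial)).
    assert (LQ := filterlim_Rmult_gen _ _ _ _ LP
      (filterlim_Rplus_gen _ _ _ _ (filterlim_Rmult_gen _ _ _ _ LR LR)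
                                   (filterlim_Rmult_gen _ _ _ _ LI LI))).
    replace (locally 0) with (locally (1 ^ 12 * (Re 0%C * Re 0%C + Im 0%C * Im 0%C)))
      by (f_equal; simpl; ring).
    revert LQ. apply filterlim_ext. intros t. ring. }
assert (Hr12 : 0 < rho ^ 12) by (apply pow_lt; lra).
apply Rmult_integral in Z. destruct Z as [Z|Z]; [lra|].
rewrite <- Cmod2_alt in Z. apply Cmod_eq_0.
apply Rsqr_0_uniq. unfold Rsqr. rewrite <- Z. ring.
Qed.

(** * Vanishing of the mode *)

Lemma is_Cderive_inv (f : R -> C) (x : R) (l : C) :
  is_Cderive f x l -> f x <> 0%C ->
  is_Cderive (fun t => / f t)%C x (- l / (f x * f x))%C.
Proof.
intros [H1 H2] H0.
assert (Hn : Re (f x) * Re (f x) + Im (f x) * Im (f x) <> 0).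
{ apply Cmod_gt_0 in H0. assert (H := Cmod2_alt (f x)).
  assert (0 < Cmod (f x) ^ 2) by (apply pow_lt; exact H0). lra. }
(* The real part of [1 / (a + i b)]; with [a] and [b] exchanged and the sign reversed it also serves
   for the imaginary part. *)
assert (K : forall (a b : R -> R) a' b', is_derive a x a' -> is_derive b x b' ->
  a x * a x + b x * b x <> 0 ->
  is_derive (fun t => a t / (a t ^ 2 + b t ^ 2)) x
    ((a' * (a x * a x + b x * b x) - a x * (2 * a x * a' + 2 * b x * b'))
      / (a x * a x + b x * b x) ^ 2)).
{ intros a b a' b' Ha Hb Hab.
  assert (Hden : is_derive (fun t => a t ^ 2 + b t ^ 2) x
      (INR 2 * a' * a x ^ 1 + INR 2 * b' * b x ^ 1))
    by exact (is_derive_plus _ _ _ _ _ (is_derive_pow _ 2 _ _ Ha) (is_derive_pow _ 2 _ _ Hb)).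
  assert (Hab' : a x ^ 2 + b x ^ 2 <> 0) by (intros E; apply Hab; rewrite <- E; ring).
  assert (H := is_derive_div _ _ _ _ _ Ha Hden Hab').
  match type of H with is_derive _ _ ?d => replace (_ / _) with d; [exact H|] end.
  simpl. field. intros E. apply Hab. rewrite <- E. ring. }
split.
- replace (Re (- l / (f x * f x))%C) with
    ((Re l * (Re (f x) * Re (f x) + Im (f x) * Im (f x))
      - Re (f x) * (2 * Re (f x) * Re l + 2 * Im (f x) * Im l))
      / (Re (f x) * Re (f x) + Im (f x) * Im (f x)) ^ 2).
  + exact (K _ _ _ _ H1 H2 Hn).
  + revert Hn. destruct (f x) as [a b], l as [p q]. unfold Re, Im. simpl. intros Hn.
    assert (Hn2 := Rmult_integral_contrapositive_currified _ _ Hn Hn).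
    field. repeat split; intros E; (apply Hn + apply Hn2); lra.
- replace (Im (- l / (f x * f x))%C) with
    (- ((Im l * (Im (f x) * Im (f x) + Re (f x) * Re (f x))
      - Im (f x) * (2 * Im (f x) * Im l + 2 * Re (f x) * Re l))
      / (Im (f x) * Im (f x) + Re (f x) * Re (f x)) ^ 2)).
  + rewrite Rplus_comm in Hn.
    refine (is_derive_ext _ _ _ _ _ (is_derive_opp _ _ _ (K _ _ _ _ H2 H1 Hn))).
    intros t. unfold Cinv, Re, Im, opp. simpl. unfold Rdiv. rewrite (Rplus_comm (snd (f t) * _)). ring.
  + revert Hn. destruct (f x) as [a b], l as [p q]. unfold Re, Im. simpl. intros Hn.
    assert (Hn2 := Rmult_integral_contrapositive_currified _ _ Hn Hn).
    field. repeat split; intros E; (apply Hn + apply Hn2); lra.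
Qed.

Lemma is_Cderive_unique (f : R -> C) (x : R) (l l' : C) :
  is_Cderive f x l -> is_Cderive f x l' -> l = l'.
Proof.
intros [H1 H2] [H1' H2'].
apply is_derive_unique in H1, H2, H1', H2'.
destruct l, l'. simpl in *. congruence.
Qed.

Lemma is_Cderive_locally_0 (f : R -> C) (a b x : R) (l : C) : a < x < b ->
  (forall t, a < t < b -> f t = 0%C) -> is_Cderive f x l -> l = 0%C.
Proof.
intros Hx H0 H. apply (is_Cderive_unique f x l 0%C H).
assert (HL : locally x (fun t => f t = 0%C)).
{ apply (locally_interval _ x a b); simpl; try lra.
  intros t Ha Hb. apply H0. split; assumption. }
split; apply (is_derive_ext_loc (fun _ => 0)); try exact (is_derive_const _ _);
  revert HL; apply filter_imp; intros t E; now rewrite E.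
Qed.

(** A second first-order operator, applied to [susy], cancels [u'] and leaves the constant
    [(lambda - 1)^2]. The identity is algebraic because [susy'] already incorporates the mode
    equation. This is where [lambda = 1] becomes exceptional. *)
Lemma susy_inverse (lambda : C) (rho : R) (u0 u1 : C) : 0 < rho < 1 ->
  (RtoC rho ^ 2 * (1 - RtoC rho ^ 2) * susy' lambda rho u0 u1
   + (2 * RtoC rho * (1 - RtoC rho ^ 2)
      + RtoC rho ^ 2 * ((1 - RtoC rho ^ 2) / RtoC rho - (lambda - 1) * RtoC rho
         + 2 * (1 - RtoC rho ^ 2) / (RtoC rho * (1 + RtoC rho ^ 2)))) * susy lambda rho u0 u1
   = (lambda - 1) * (lambda - 1) * u0)%C.
Proof.
intros Hr. destruct (unit_interval_neq_0 rho Hr) as [N1 [N2 N3]].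
unfold susy, susy'. push_RtoC. simpl. field. repeat split; assumption.
Qed.

(** Each of the three real coefficients is at most [rho^(-3)], one power below the blow-up in
    [frob_rho_lower]. *)
Lemma susy_bound (lambda : C) (rho K : R) (u0 u1 : C) : 0 < rho < 1 ->
  Cmod u0 <= K -> Cmod u1 <= K ->
  Cmod (susy lambda rho u0 u1) <= (2 + Cmod (lambda - 1)) * K * / rho ^ 3.
Proof.
intros Hr H0 H1. unfold susy, Cminus at 1.
assert (P0 := Cmod_ge_0 u0). assert (P1 := Cmod_ge_0 u1).
assert (PL := Cmod_ge_0 (lambda - 1)).
assert (Hi : 0 < / rho ^ 3) by (apply Rinv_0_lt_compat, pow_lt; lra).
assert (B1 : 0 <= (1 - rho ^ 2) / rho ^ 2 <= / rho ^ 3).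
{ split; [apply Rmult_le_pos; [nra | left; apply Rinv_0_lt_compat, pow_lt; lra]|].
  replace ((1 - rho ^ 2) / rho ^ 2) with ((rho * (1 - rho ^ 2)) * / rho ^ 3) by (field; lra).
  rewrite <- (Rmult_1_l (/ rho ^ 3)) at 2.
  assert (0 < rho ^ 3) by (apply pow_lt; lra). apply Rmult_le_compat_r; lra. }
assert (B2 : 0 <= (1 - rho ^ 2) ^ 2 / (rho ^ 3 * (1 + rho ^ 2)) <= / rho ^ 3).
{ replace ((1 - rho ^ 2) ^ 2 / (rho ^ 3 * (1 + rho ^ 2)))
    with ((1 - rho ^ 2) ^ 2 / (1 + rho ^ 2) * / rho ^ 3) by (field; nra).
  assert (0 <= (1 - rho ^ 2) ^ 2 / (1 + rho ^ 2) <= 1).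
  { split; [apply Rmult_le_pos; [apply pow2_ge_0 | left; apply Rinv_0_lt_compat; nra]|].
    apply (Rmult_le_reg_r (1 + rho ^ 2)); [nra|].
    unfold Rdiv. rewrite Rmult_assoc, Rinv_l by nra.
    assert (Hs : 0 < rho ^ 2 < 1) by nra. revert Hs. generalize (rho ^ 2). intros s Hs. nra. }
  split; [apply Rmult_le_pos; lra|].
  rewrite <- (Rmult_1_l (/ rho ^ 3)) at 2. apply Rmult_le_compat_r; lra. }
assert (B3 : 0 <= / rho <= / rho ^ 3).
{ split; [left; apply Rinv_0_lt_compat; lra|].
  apply Rinv_le_contravar; [apply pow_lt; lra | nra]. }
eapply Rle_trans; [apply Cmod_triangle|].
rewrite Cmod_opp, !Cmod_mult, Cmod_R, Rabs_pos_eq by lra.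
assert (T := Cmod_triangle (RtoC ((1 - rho ^ 2) ^ 2 / (rho ^ 3 * (1 + rho ^ 2))))
  ((lambda - 1) * RtoC (/ rho))).
rewrite Cmod_mult, !Cmod_R, !Rabs_pos_eq in T by lra.
assert (M1 : (1 - rho ^ 2) / rho ^ 2 * Cmod u1 <= / rho ^ 3 * K)
  by (apply Rmult_le_compat; lra).
assert (M3 : Cmod (lambda - 1) * / rho <= Cmod (lambda - 1) * / rho ^ 3)
  by (apply Rmult_le_compat_l; lra).
assert (M2 : Cmod (RtoC ((1 - rho ^ 2) ^ 2 / (rho ^ 3 * (1 + rho ^ 2)))
    + (lambda - 1) * RtoC (/ rho)) * Cmod u0
  <= (/ rho ^ 3 + Cmod (lambda - 1) * / rho ^ 3) * K)
  by (apply Rmult_le_compat; try apply Cmod_ge_0; lra).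
lra.
Qed.

Lemma frob_rho_lower (lambda : C) : 0 <= Re lambda ->
  exists c d, 0 < c /\ 0 < d < 1 /\
    forall rho, 0 < rho < d -> c * / rho ^ 4 <= Cmod (frob_rho lambda rho).
Proof.
intros Hl. destruct (frob_sol_lower lambda Hl) as [c [D [Hc H]]].
(* The radius is chosen so that [|D| rho^2 <= c/2]: the lower-order term costs half of the leading
   constant. *)
exists (c / 2), (Rmin (1 / 2) (c / (2 * (Rabs D + 1)))).
assert (HD : 0 < Rabs D + 1) by (generalize (Rabs_pos D); lra).
split; [lra|]. split.
{ split; [apply Rmin_glb_lt; [lra | apply Rdiv_lt_0_compat; lra]|].
  eapply Rle_lt_trans; [apply Rmin_l | lra]. }
intros rho [Hr0 Hr].
assert (Hr1 : rho < 1 / 2) by (eapply Rlt_le_trans; [exact Hr | apply Rmin_l]).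
assert (Hr2 : rho < c / (2 * (Rabs D + 1)))
  by (eapply Rlt_le_trans; [exact Hr | apply Rmin_r]).
assert (Hr3 : rho * (Rabs D + 1) <= c / 2).
{ apply Rle_trans with (c / (2 * (Rabs D + 1)) * (Rabs D + 1)).
  - apply Rmult_le_compat_r; lra.
  - right. field. lra. }
specialize (H (1 - rho ^ 2) ltac:(nra)).
fold (frob_rho lambda rho) in H.
replace (1 - (1 - rho ^ 2)) with (rho ^ 2) in H by ring.
eapply Rle_trans; [|exact H].
assert (Hi : 0 < / rho ^ 4) by (apply Rinv_0_lt_compat, pow_lt; lra).
replace (c * / (rho ^ 2) ^ 2 - D * / rho ^ 2) with ((c - D * rho ^ 2) * / rho ^ 4)
  by (field; lra).
apply Rmult_le_compat_r; [lra|].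
assert (D * rho ^ 2 <= rho * (Rabs D + 1)); [|lra].
apply Rle_trans with (Rabs D * rho ^ 2).
- apply Rmult_le_compat_r; [apply pow2_ge_0 | apply Rle_abs].
- assert (0 <= Rabs D * (rho * (1 - rho)))
    by (apply Rmult_le_pos; [apply Rabs_pos | apply Rmult_le_pos; lra]). lra.
Qed.

(** The derivative of [y / z] is [-W / z^2 = 0], so [y = k z]; comparing rates gives [c |k| <= K s]
    for arbitrarily small [s], hence [k = 0]. *)
Lemma proportional_zero (y y1 z z1 : R -> C) (c d K : R) : 0 < c -> 0 < d ->
  (forall t, 0 < t < d -> is_Cderive y t (y1 t)) ->
  (forall t, 0 < t < d -> is_Cderive z t (z1 t)) ->
  (forall t, 0 < t < d -> (y t * z1 t - y1 t * z t = 0)%C) ->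
  (forall t, 0 < t < d -> c * / t ^ 4 <= Cmod (z t)) ->
  (forall t, 0 < t < d -> Cmod (y t) <= K * / t ^ 3) ->
  forall t, 0 < t < d -> y t = 0%C.
Proof.
intros Hc Hd Dy Dz HW Hz Hy t Ht.
assert (Hz0 : forall s, 0 < s < d -> z s <> 0%C).
{ intros s Hs. apply Cmod_gt_0. eapply Rlt_le_trans; [|apply Hz, Hs].
  apply Rmult_lt_0_compat; [exact Hc|]. apply Rinv_0_lt_compat, pow_lt. lra. }
assert (Hconst : forall s, 0 < s <= t -> (y s * / z s = y t * / z t)%C).
{ intros s Hs. apply (is_Cderive_0_constant (fun r => y r * / z r)%C); [lra|].
  intros r Hr. assert (Hr' : 0 < r < d) by lra.
  eapply is_Cderive_eq; cycle 1.
  - apply is_Cderive_mult; [apply Dy, Hr'|].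
    apply is_Cderive_inv; [apply Dz, Hr' | apply Hz0, Hr'].
  - transitivity (- (y r * z1 r - y1 r * z r) / (z r * z r))%C.
    + field. apply Hz0, Hr'.
    + rewrite HW by exact Hr'. field. apply Hz0, Hr'. }
set (k := (y t * / z t)%C) in *.
assert (Hk : forall s, 0 < s <= t -> c * Cmod k <= K * s).
{ intros s Hs. specialize (Hconst s Hs). assert (Hs' : 0 < s < d) by lra.
  specialize (Hz s Hs'). specialize (Hy s Hs'). specialize (Hz0 s Hs').
  replace (y s) with (k * z s)%C in Hy by (rewrite <- Hconst; field; exact Hz0).
  rewrite Cmod_mult in Hy.
  assert (Hs4 : 0 < / s ^ 4) by (apply Rinv_0_lt_compat, pow_lt; lra).
  apply (Rmult_le_reg_r (/ s ^ 4)); [exact Hs4|].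
  replace (K * s * / s ^ 4) with (K * / s ^ 3) by (field; lra).
  eapply Rle_trans; [|exact Hy].
  replace (c * Cmod k * / s ^ 4) with (Cmod k * (c * / s ^ 4)) by ring.
  apply Rmult_le_compat_l; [apply Cmod_ge_0 | exact Hz]. }
assert (Hk0 : k = 0%C).
{ apply Cmod_eq_0. destruct (Rle_lt_or_eq_dec _ _ (Cmod_ge_0 k)) as [Hp|E]; [exfalso|now symmetry].
  assert (Hck : 0 < c * Cmod k) by (apply Rmult_lt_0_compat; assumption).
  assert (HK : 0 < K) by (specialize (Hk t ltac:(lra)); nra).
  set (s := Rmin t (c * Cmod k / (2 * K))).
  assert (Hs0 : 0 < s) by (apply Rmin_glb_lt; [lra | apply Rdiv_lt_0_compat; lra]).
  specialize (Hk s (conj Hs0 (Rmin_l _ _))).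
  assert (Hs2 : s <= c * Cmod k / (2 * K)) by apply Rmin_r.
  apply (Rmult_le_compat_l K) in Hs2; [|lra].
  replace (K * (c * Cmod k / (2 * K))) with (c * Cmod k / 2) in Hs2 by (field; lra). lra. }
replace (y t) with (k * z t)%C by (unfold k; field; apply Hz0, Ht).
rewrite Hk0. ring.
Qed.

(** Gronwall: the energy [E = |u|^2 + |u'|^2] satisfies [E' <= (1 + 3 M) E], so
    [E t * exp (- (1 + 3 M) t)] is nonincreasing. *)
Lemma linear_ode_unique (u0 u1 u2 : R -> C) (a b M : R) : a <= b -> 0 <= M ->
  (forall t, a <= t <= b -> is_Cderive u0 t (u1 t)) ->
  (forall t, a <= t <= b -> is_Cderive u1 t (u2 t)) ->
  (forall t, a <= t <= b -> Cmod (u2 t) <= M * (Cmod (u0 t) + Cmod (u1 t))) ->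
  u0 a = 0%C -> u1 a = 0%C -> u0 b = 0%C.
Proof.
intros Hab HM D0 D1 HB Z0 Z1.
set (E := fun t => (Re (u0 t) ^ 2 + Im (u0 t) ^ 2) + (Re (u1 t) ^ 2 + Im (u1 t) ^ 2)).
set (E' := fun t => 2 * (Re (u0 t) * Re (u1 t) + Im (u0 t) * Im (u1 t))
                    + 2 * (Re (u1 t) * Re (u2 t) + Im (u1 t) * Im (u2 t))).
assert (DE : forall t, a <= t <= b -> is_derive E t (E' t)).
{ intros t Ht. exact (is_derive_plus _ _ _ _ _
    (is_derive_Cmod_sqr _ _ _ (D0 t Ht)) (is_derive_Cmod_sqr _ _ _ (D1 t Ht))). }
set (C0 := 1 + 3 * M).
assert (HE : forall t, a <= t <= b -> E' t <= C0 * E t).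
{ intros t Ht. unfold E', E, C0. rewrite <- !Cmod2_alt. specialize (HB t Ht).
  assert (T1 := Cmod_mult_ge (u0 t) (u1 t)). assert (T2 := Cmod_mult_ge (u1 t) (u2 t)).
  assert (P0 := Cmod_ge_0 (u0 t)). assert (P1 := Cmod_ge_0 (u1 t)).
  revert T1 T2 HB P0 P1. generalize (Cmod (u0 t)) (Cmod (u1 t)) (Cmod (u2 t)).
  intros p q r T1 T2 HB P0 P1.
  assert (Hqr : q * r <= q * (M * (p + q))) by (apply Rmult_le_compat_l; lra).
  assert (H1 : 0 <= (p - q) ^ 2) by apply pow2_ge_0.
  assert (H2 : 0 <= M * (p - q) ^ 2) by (apply Rmult_le_pos; lra).
  assert (H3 : 0 <= M * p ^ 2) by (apply Rmult_le_pos; [lra | apply pow2_ge_0]).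
  lra. }
assert (Hinc : - (E a * exp (- C0 * a)) <= - (E b * exp (- C0 * b))).
{ apply (increment_nonneg (fun t => - (E t * exp (- C0 * t)))
    (fun t => - (E' t * exp (- C0 * t) + E t * (- C0 * exp (- C0 * t)))) a b Hab).
  - intros t Ht. apply (is_derive_opp (fun t => E t * exp (- C0 * t))).
    apply (is_derive_mult E (fun t => exp (- C0 * t)) t _ _ (DE t Ht)); [|exact Rmult_comm].
    auto_derive; [trivial | ring].
  - intros t Ht. specialize (HE t Ht). assert (He := exp_pos (- C0 * t)). nra. }
assert (Ea : E a = 0) by (unfold E; rewrite Z0, Z1; simpl; ring).
rewrite Ea in Hinc. assert (He := exp_pos (- C0 * b)).
assert (Eb : E b <= 0) by nra.
unfold E in Eb. rewrite <- !Cmod2_alt in Eb.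
apply Cmod_eq_0. generalize (pow2_ge_0 (Cmod (u1 b))) (Cmod_ge_0 (u0 b)). nra.
Qed.

(** Provides the constant for [linear_ode_unique] on a compact part of (0,1), away from both
    singular points; [|V| <= 2] comes from the cosine form. *)
Lemma ode_bound (lambda : C) (a b rho : R) (u0 u1 u2 : C) :
  0 < a -> b < 1 -> a <= rho <= b -> ode lambda rho u0 u1 u2 ->
  Cmod u2 <= (2 / a + 2 * Cmod lambda + Cmod (lambda * (lambda + 1)) + 2 / a ^ 2)
             / (1 - b ^ 2) * (Cmod u0 + Cmod u1).
Proof.
intros Ha Hb Hr E.
set (M := 2 / a + 2 * Cmod lambda + Cmod (lambda * (lambda + 1)) + 2 / a ^ 2).
assert (Hs : 0 < 1 - b ^ 2 <= 1 - rho ^ 2) by nra.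
assert (P0 := Cmod_ge_0 u0). assert (P1 := Cmod_ge_0 u1). assert (P2 := Cmod_ge_0 u2).
assert (H : (1 - rho ^ 2) * Cmod u2 <= M * (Cmod u0 + Cmod u1)).
{ replace ((1 - rho ^ 2) * Cmod u2) with (Cmod (RtoC (1 - rho ^ 2) * u2))
    by (rewrite Cmod_mult, Cmod_R, Rabs_pos_eq; lra).
  replace (RtoC (1 - rho ^ 2) * u2)%C with
    ((- RtoC (2 * ((1 - rho ^ 2) / rho)) * u1 + 2 * lambda * RtoC rho * u1)
     + (lambda * (lambda + 1) * u0 + RtoC (V rho / rho ^ 2) * u0))%C
    by (unfold ode, ode_lhs in E;
        transitivity (RtoC (1 - rho ^ 2) * u2 + 0)%C; [rewrite <- E|]; ring).
  eapply Rle_trans; [apply Cmod_triangle|].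
  assert (T1 := Cmod_triangle (- RtoC (2 * ((1 - rho ^ 2) / rho)) * u1)
                              (2 * lambda * RtoC rho * u1)).
  assert (T2 := Cmod_triangle (lambda * (lambda + 1) * u0) (RtoC (V rho / rho ^ 2) * u0)).
  rewrite (Cmod_mult _ u1), (Cmod_mult _ u1), Cmod_opp, (Cmod_mult _ (RtoC rho)),
    (Cmod_mult 2), !Cmod_R, (Rabs_pos_eq 2), (Rabs_pos_eq rho) in T1 by lra.
  rewrite (Cmod_mult _ u0), (Cmod_mult _ u0), Cmod_R in T2.
  assert (Hia : / rho <= / a) by (apply Rinv_le_contravar; lra).
  assert (Hia2 : / rho ^ 2 <= / a ^ 2)
    by (apply Rinv_le_contravar; [apply pow_lt; lra | apply pow_incr; lra]).
  assert (Hir : 0 < / rho) by (apply Rinv_0_lt_compat; lra).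
  assert (Hir2 : 0 < / rho ^ 2) by (apply Rinv_0_lt_compat, pow_lt; lra).
  assert (B1 : Rabs (2 * ((1 - rho ^ 2) / rho)) <= 2 / a).
  { rewrite Rabs_pos_eq; [|unfold Rdiv; nra].
    unfold Rdiv. apply Rmult_le_compat_l; [lra|]. nra. }
  assert (B2 : Rabs (V rho / rho ^ 2) <= 2 / a ^ 2).
  { unfold Rdiv. rewrite Rabs_mult, (Rabs_pos_eq (/ rho ^ 2)) by lra.
    apply Rmult_le_compat; try lra; [apply Rabs_pos|].
    unfold V. apply Rabs_le. generalize (COS_bound (4 * atan rho)). lra. }
  assert (PL := Cmod_ge_0 lambda).
  assert (M1 : Rabs (2 * ((1 - rho ^ 2) / rho)) * Cmod u1 <= 2 / a * Cmod u1)
    by (apply Rmult_le_compat_r; lra).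
  assert (M2 : Rabs (V rho / rho ^ 2) * Cmod u0 <= 2 / a ^ 2 * Cmod u0)
    by (apply Rmult_le_compat_r; lra).
  assert (M3 : 2 * Cmod lambda * rho * Cmod u1 <= 2 * Cmod lambda * Cmod u1).
  { apply Rmult_le_compat_r; [lra|]. assert (0 <= Cmod lambda * (1 - rho)) by (apply Rmult_le_pos; lra). lra. }
  assert (N1 : 0 < 2 / a) by (apply Rdiv_lt_0_compat; lra).
  assert (N2 : 0 < 2 / a ^ 2) by (apply Rdiv_lt_0_compat; [lra | apply pow_lt; lra]).
  assert (N3 := Cmod_ge_0 (lambda * (lambda + 1))).
  assert (Q1 : 0 <= (2 / a + 2 * Cmod lambda) * Cmod u0) by (apply Rmult_le_pos; lra).
  assert (Q2 : 0 <= (Cmod (lambda * (lambda + 1)) + 2 / a ^ 2) * Cmod u1)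
    by (apply Rmult_le_pos; lra).
  unfold M. lra. }
apply (Rmult_le_reg_l (1 - b ^ 2)); [lra|].
replace ((1 - b ^ 2) * (M / (1 - b ^ 2) * (Cmod u0 + Cmod u1)))
  with (M * (Cmod u0 + Cmod u1)) by (field; lra).
eapply Rle_trans; [|exact H]. apply Rmult_le_compat_r; lra.
Qed.

(** Regularity enters through limits at the end points: those of [u], [u'], [u''] at 1 make the
    Wronskian vanish, those of [u], [u'] at 0 bound [susy]. *)
Lemma no_unstable_mode (lambda : C) (u0 u1 u2 : R -> C) :
  0 <= Re lambda -> lambda <> RtoC 1 ->
  (forall rho, 0 < rho < 1 -> is_Cderive u0 rho (u1 rho)) ->
  (forall rho, 0 < rho < 1 -> is_Cderive u1 rho (u2 rho)) ->
  (forall rho, 0 < rho < 1 -> ode lambda rho (u0 rho) (u1 rho) (u2 rho)) ->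
  is_Climit (at_left 1) u0 (u0 1) -> is_Climit (at_left 1) u1 (u1 1) ->
  is_Climit (at_left 1) u2 (u2 1) ->
  is_Climit (at_right 0) u0 (u0 0) -> is_Climit (at_right 0) u1 (u1 0) ->
  forall rho, 0 < rho < 1 -> u0 rho = 0%C.
Proof.
intros Hl Hne D0 D1 Hode L0 L1 L2 R0 R1.
assert (HW := wronskian_zero lambda u0 u1 u2 Hl D0 D1 Hode L0 L1 L2).
destruct (frob_rho_lower lambda Hl) as [c [d1 [Hc [Hd1 HN]]]].
destruct (is_Climit_Cmod_bounded _ _ R0) as [K0 B0].
destruct (is_Climit_Cmod_bounded _ _ R1) as [K1 B1].
destruct (filter_and _ _ B0 B1) as [d2 B].
set (d := Rmin d1 d2).
assert (Hd0 : 0 < d) by (apply Rmin_glb_lt; [lra | apply cond_pos]).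
assert (Hdd1 : d <= d1) by apply Rmin_l. assert (Hdd2 : d <= d2) by apply Rmin_r.
set (K := Rmax K0 K1).
assert (HB : forall t, 0 < t < d -> Cmod (u0 t) <= K /\ Cmod (u1 t) <= K).
{ intros t Ht. destruct (B t) as [b0 b1].
  - change (Rabs (t - 0) < d2). apply Rabs_def1; lra.
  - lra.
  - split; (eapply Rle_trans; [eassumption|]); [apply Rmax_l | apply Rmax_r]. }
assert (HY : forall t, 0 < t < d -> susy lambda t (u0 t) (u1 t) = 0%C).
{ apply (proportional_zero _ (fun t => susy' lambda t (u0 t) (u1 t))
    (frob_rho lambda) (frob_rho' lambda) c d ((2 + Cmod (lambda - 1)) * K)); try assumption.
  - intros t Ht. apply (is_Cderive_susy lambda t u0 u1 (u2 t)); try lra.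
    + apply D0; lra.
    + apply D1; lra.
    + apply Hode; lra.
  - intros t Ht. apply is_Cderive_frob_rho; [exact Hl | lra].
  - intros t Ht. apply HW. lra.
  - intros t Ht. apply HN. lra.
  - intros t Ht. apply susy_bound; [lra | apply HB, Ht | apply HB, Ht]. }
assert (HU : forall t, 0 < t < d -> u0 t = 0%C).
{ intros t Ht. assert (Ht1 : 0 < t < 1) by lra.
  assert (HY' : susy' lambda t (u0 t) (u1 t) = 0%C).
  { apply (is_Cderive_locally_0 _ 0 d t _ Ht HY).
    apply (is_Cderive_susy lambda t u0 u1 (u2 t)); auto. }
  assert (Einv := susy_inverse lambda t (u0 t) (u1 t) Ht1).
  rewrite HY', (HY t Ht), !Cmult_0_r, Cplus_0_l in Einv.
  assert (Hm : (lambda - 1)%C <> 0%C).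
  { intros E. apply Hne. transitivity (lambda - 1 + 1)%C; [ring|]. rewrite E. ring. }
  transitivity ((lambda - 1) * (lambda - 1) * u0 t / ((lambda - 1) * (lambda - 1)))%C.
  - field. exact Hm.
  - rewrite <- Einv. field. exact Hm. }
intros rho Hr.
destruct (Rlt_le_dec rho d) as [Hlt|Hle]; [apply HU; lra|].
(* The initial data at [d / 2], inside the interval where the mode vanishes, are zero; uniqueness
   carries this on to [rho]. *)
assert (Hd2 : 0 < d / 2) by lra.
eapply (linear_ode_unique u0 u1 u2 (d / 2) rho _); try lra.
2:{ intros t Ht. apply D0. lra. }
2:{ intros t Ht. apply D1. lra. }
2:{ intros t Ht. apply (ode_bound lambda (d / 2) rho t); try lra. apply Hode. lra. }
- apply Rmult_le_pos; [|left; apply Rinv_0_lt_compat; nra].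
  generalize (Cmod_ge_0 lambda) (Cmod_ge_0 (lambda * (lambda + 1))).
  assert (0 < 2 / (d / 2)) by (apply Rdiv_lt_0_compat; lra).
  assert (0 < 2 / (d / 2) ^ 2) by (apply Rdiv_lt_0_compat; [lra | apply pow_lt; lra]). lra.
- apply HU. lra.
- apply (is_Cderive_locally_0 u0 0 d (d / 2)); [lra | exact HU | apply D0; lra].
Qed.

(** * From smoothness on the closed interval to the theorem *)

Lemma smooth_on_is_Cderive (g : nat -> R -> C) :
  (forall n x, unit_interval x -> is_derive_on unit_interval (g n) x (g (S n) x)) ->
  forall n x, 0 < x < 1 -> is_Cderive (g n) x (g (S n) x).
Proof.
intros Hg n x Hx.
assert (H : @is_derive R_AbsRing C_R_NormedModule (g n) x (g (S n) x)).
{ apply (is_derive_on_interior unit_interval); [|apply Hg; unfold unit_interval; lra].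
  apply (locally_interval _ x 0 1); simpl; try lra.
  intros t H0 H1. split; lra. }
split.
- apply (filterdiff_comp' (g n) (fun z : C_R_NormedModule => Re z) x _ (fun z => Re z) H).
  apply filterdiff_linear, is_linear_fst.
- apply (filterdiff_comp' (g n) (fun z : C_R_NormedModule => Im z) x _ (fun z => Im z) H).
  apply filterdiff_linear, is_linear_snd.
Qed.

Lemma is_derive_on_Climit (D : R -> Prop) (f : R -> C) (x : R) (l : C)
    (F : (R -> Prop) -> Prop) :
  filter_le F (within D (locally x)) -> is_derive_on D f x l -> is_Climit F f (f x).
Proof.
intros HF Hd.
assert (Hlim : filterlim f (within D (locally x)) (@locally C_R_NormedModule (f x))).
{ apply (filterdiff_continuous_aux (F := within D (locally x)) f).
  - eexists. exact Hd.
  - intros P HP. apply filter_le_within. exact HP. }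
assert (Hlim' := filterlim_filter_le_1 _ HF Hlim).
split; (eapply filterlim_comp; [exact Hlim'|]).
- destruct (f x) as [p q]. exact (continuous_fst p q).
- destruct (f x) as [p q]. exact (continuous_snd p q).
Qed.

Lemma at_left_1_unit_interval : filter_le (at_left 1) (within unit_interval (locally 1)).
Proof.
intros P HP. generalize (filter_and _ _ at_left_1_interval (filter_le_within (F := locally 1) (fun t => t < 1) _ HP)).
apply filter_imp. intros t [Ht H]. apply H. split; lra.
Qed.

Lemma at_right_0_unit_interval : filter_le (at_right 0) (within unit_interval (locally 0)).
Proof.
intros P HP. generalize (filter_and _ _ at_right_0_interval (filter_le_within (F := locally 0) (fun t => 0 < t) _ HP)).
apply filter_imp. intros t [Ht H]. apply H. split; lra.
Qed.

(** Transfers derivatives from the smooth tower to [u], which is tied to it only on the interval.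
    Used twice, the second time with [CDerive u] as [f]. *)
Lemma CDerive_eq (f g : R -> C) (x : R) (l : C) :
  (forall t, 0 < t < 1 -> f t = g t) -> 0 < x < 1 -> is_Cderive g x l -> CDerive f x = l.
Proof.
intros Hfg Hx [H1 H2].
assert (HL : locally x (fun t => f t = g t)).
{ apply (locally_interval _ x 0 1); simpl; try lra. intros t A B. apply Hfg. split; assumption. }
rewrite (surjective_pairing l). unfold CDerive. f_equal.
- rewrite (Derive_ext_loc _ (fun t => Re (g t))); [exact (is_derive_unique _ _ _ H1)|].
  revert HL. apply filter_imp. now intros t ->.
- rewrite (Derive_ext_loc _ (fun t => Im (g t))); [exact (is_derive_unique _ _ _ H2)|].
  revert HL. apply filter_imp. now intros t ->.
Qed.

Theorem theorem1p1 (lambda : C) (hre : 0 <= Re lambda) (hne : lambda <> RtoC 1) :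
  ~ exists u : R -> C,
      smooth_on unit_interval u /\
      (exists rho : R, 0 <= rho <= 1 /\ u rho <> RtoC 0) /\
      (forall rho : R, 0 < rho < 1 -> mode_equation lambda u rho).
Proof.
intros [u [[g [Hgu Hg]] [[r [Hr Hur]] Heq]]].
assert (HD := smooth_on_is_Cderive g Hg).
assert (I0 : unit_interval 0) by (split; lra).
assert (I1 : unit_interval 1) by (split; lra).
assert (HL : forall n, is_Climit (at_left 1) (g n) (g n 1)).
{ intros n. eapply is_derive_on_Climit; [apply at_left_1_unit_interval | apply Hg, I1]. }
assert (HR : forall n, is_Climit (at_right 0) (g n) (g n 0)).
{ intros n. eapply is_derive_on_Climit; [apply at_right_0_unit_interval | apply Hg, I0]. }
assert (Hu : forall t, 0 < t < 1 -> u t = g 0%nat t)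
  by (intros t Ht; symmetry; apply Hgu; split; lra).
assert (Hode : forall t, 0 < t < 1 -> ode lambda t (g 0%nat t) (g 1%nat t) (g 2%nat t)).
{ intros t Ht. specialize (Heq t Ht). unfold mode_equation in Heq.
  assert (E1 : forall s, 0 < s < 1 -> CDerive u s = g 1%nat s)
    by (intros s Hs; exact (CDerive_eq u _ s _ Hu Hs (HD 0%nat s Hs))).
  rewrite (CDerive_eq (CDerive u) _ t _ E1 Ht (HD 1%nat t Ht)), (E1 t Ht), (Hu t Ht) in Heq.
  exact Heq. }
assert (Hz := no_unstable_mode lambda _ _ _ hre hne (HD 0%nat) (HD 1%nat) Hode
  (HL 0%nat) (HL 1%nat) (HL 2%nat) (HR 0%nat) (HR 1%nat)).
apply Hur. rewrite <- Hgu by exact Hr.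
(* At either end point the value is a one-sided limit of zeros. *)
destruct (Rle_lt_or_eq_dec 0 r (proj1 Hr)) as [Hr0|<-].
- destruct (Rle_lt_or_eq_dec r 1 (proj2 Hr)) as [Hr1| ->]; [apply Hz; lra|].
  apply (is_Climit_eventually_0 _ _ (filter_imp _ _ Hz at_left_1_interval) (HL 0%nat)).
- apply (is_Climit_eventually_0 _ _ (filter_imp _ _ Hz at_right_0_interval) (HR 0%nat)).
Qed.
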